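(* For an integer $l \geq 3$, let $\epsilon_l$ be a root of the polynomial $X^3 + (l-1)X^2 - lX - 1 \in \mathbb{Z}[X]$, let $\mathbb{U}_l$ be the unit group of the ring of integers of the cubic field $\mathbb{Q}(\epsilon_l)$, and let $$j_l := \left(\mathbb{U}_l : \langle -1, \epsilon_l, \epsilon_l - 1\rangle\right)$$ be the index in $\mathbb{U}_l$ of the subgroup generated by $-1$, $\epsilon_l$ and $\epsilon_l - 1$. Then for any given prime $p \geq 3$, there are only finitely many $l \geq 3$ for which $p$ divides $j_l$. Hence, for any given integer $N \geq 2$, we have $\gcd(j_l, N!) = 1$ for all $l \geq l_N$, where $l_N$ is an effectively computable bound depending on $N$.
   Context: For $l \geq 3$ the polynomial $X^3 + (l-1)X^2 - lX - 1$ defines a non-Galois totally real cubic field $\mathbb{Q}(\epsilon_l)$; both $\epsilon_l$ and $\epsilon_l - 1$ are units of its ring of integers, and the unit group $\mathbb{U}_l$ has rank $2$, so the index $j_l$ is finite. *)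

(* Defs.v *)
From HB Require Import structures.
From mathcomp Require Import all_boot all_order all_algebra all_field.
From mathcomp Require Import finmap.
From mathcomp Require Import boolp classical_sets functions cardinality.

Set Implicit Arguments.
Unset Strict Implicit.
Unset Printing Implicit Defensive.

Import GRing.Theory Num.Theory.
Local Open Scope classical_set_scope.
Local Open Scope ring_scope.

Definition ennola_poly (l : nat) : {poly int} :=
  'X^3 + (l%:R - 1) *: 'X^2 - l%:R *: 'X - 1.

Definition is_eps (l : nat) (e : algC) : Prop :=
  root (map_poly intr (ennola_poly l)) e.

Definition generated_field (e : algC) : set algC :=
  smallest [set K : set algC | divring_closed (mem K)] [set e].

Definition integer_ring (e : algC) : set algC :=
  [set x | generated_field e x /\ x \in Aint].

Definition unit_group (e : algC) : set algC :=
  [set x | integer_ring e x /\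
           exists y : algC, integer_ring e y /\ x * y = 1].

(* Multiplicative subgroup of algC generated by G; as 0^-1 = 0, this is
   meant for sets G not containing 0. *)
Definition generated_subgroup (G : set algC) : set algC :=
  smallest [set H : set algC | divr_closed (mem H)] G.

Definition cosets (U H : set algC) : set (set algC) :=
  [set [set x * h | h in H] | x in U].

(* fset_set is fset0 on infinite sets, so an infinite index is 0. *)
Definition group_index (U H : set algC) : nat :=
  #|` fset_set (cosets U H)|.

Definition unit_index (e : algC) : nat :=
  group_index (unit_group e) (generated_subgroup [set -1; e; e - 1]).

(* General recursive functions: the smallest class containing the initial
   functions and closed under composition, primitive recursion and
   minimization of regular functions. *)
Inductive recursive : forall n : nat, (n.-tuple nat -> nat) -> Prop :=
| recursive_ext n (f g : n.-tuple nat -> nat) :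
    f =1 g -> recursive f -> recursive g
| recursive_zero n : recursive (fun _ : n.-tuple nat => 0%N)
| recursive_succ : recursive (fun v : 1.-tuple nat => (thead v).+1)
| recursive_proj n (i : 'I_n) : recursive (fun v : n.-tuple nat => tnth v i)
| recursive_comp m n (f : m.-tuple nat -> nat)
    (g : 'I_m -> n.-tuple nat -> nat) :
    recursive f -> (forall i, recursive (g i)) ->
    recursive (fun v : n.-tuple nat => f [tuple g i v | i < m])
| recursive_prim n (f : n.-tuple nat -> nat) (g : n.+2.-tuple nat -> nat) :
    recursive f -> recursive g ->
    recursive (fun v : n.+1.-tuple nat =>
      nat_rect (fun=> nat) (f [tuple of behead v])
        (fun k r => g [tuple of k :: r :: behead v]) (thead v))
| recursive_mu n (f : n.+1.-tuple nat -> nat)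
    (f_regular : forall v : n.-tuple nat,
       exists y, f [tuple of y :: v] == 0%N) :
    recursive f ->
    recursive (fun v : n.-tuple nat => ex_minn (f_regular v)).

Definition computable (f : nat -> nat) : Prop :=
  recursive (fun v : 1.-tuple nat => f (thead v)).

(* Main.v *)
Require Import Defs.
From HB Require Import structures.
From mathcomp Require Import all_boot all_order all_algebra all_field.
From mathcomp Require Import finmap.
From mathcomp Require Import boolp classical_sets functions cardinality.
From mathcomp Require Import fingroup pgroup.
From mathcomp Require Import ring lra zify.
Import Order.TTheory GRing.Theory Num.Theory.

(** Write f = X(X-1)(X+l) - 1.  Its roots are r1 ~ -1/l, r2 ~ 1 + 1/l and
    r3 ~ -l, so e^I (e-1)^J has conjugates of size l^-I, l^-J and l^(I+J).

    Finiteness of the index: multiplying a unit x by one of e, e-1, their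
    inverses and their quotients decreases the positive integer Tr(x^2) as
    long as some conjugate of x exceeds 4l, so each coset contains a unit with
    bounded conjugates.

    If a prime p divides the index, Cauchy's theorem gives a unit x, not in
    <-1, e, e-1>, with x^p = +-e^a (e-1)^b, and a, b are not both divisible by
    p.  Up to powers of x and p-th powers of units, (a, b) may be replaced by
    any (ka + pi, kb + pj).  Put lam = l^(1/p).  If p divides a, b or a+b, one
    can reach (-p, 1), (1, -p) or (1, p-1), and Tr x = +-(l + m/p + o(1)) with
    m = +-1 mod p, which is not an integer.  Otherwise one can reach
    (1-p, B) and (A, 1-p) with 0 < A, B < p-1.  The two traces, up to sign,
    are both lam^(p-1) + o(1), so they are equal; but their difference
    multiplied by p lam^p is Q(lam) + o(1) for an integer polynomial Q, and
    Q is nonzero because 2p divides Q(1) - k for some 0 < |k| < 2p.  This is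
    impossible once lam exceeds a constant multiple of p^3. *)

(** * Expansion of p-th roots near 1 *)

Section Estimates.
Local Open Scope ring_scope.
Variable R : realFieldType.
Implicit Types (x y t u w : R) (m n : int).

(** Negative exponents reduce to the ordinary Bernoulli inequality for [1 - x], since
    [1 - x <= (1 + x)^-1]. *)
Lemma bernoulli_exprz x n : `|x| <= 1/2 -> 1 + n%:~R * x <= (1 + x) ^ n.
Proof.
rewrite ler_norml => /andP[x1 x2].
have bern (y : R) (k : nat) : -1 <= y -> 1 + k%:R * y <= (1 + y) ^+ k.
  move=> y1; elim: k => [|k IH]; first by rewrite mul0r addr0 expr0.
  rewrite exprS; have k0 : 0 <= k%:R :> R by [].
  have y0 : 0 <= 1 + y by lra.
  apply: le_trans (ler_wpM2l y0 IH).
  rewrite -natr1; have := mulr_ge0 k0 (sqr_ge0 y); nra.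
case: n => k; first by apply: bern; lra.
rewrite NegzE mulrNz mulNr -invr_expz -exprVn.
apply: (@le_trans _ _ ((1 - x) ^+ k.+1)).
  have := bern (- x) k.+1; rewrite mulrN; apply; lra.
apply: lerXn2r; rewrite ?nnegrE ?invr_ge0; try lra.
by rewrite -[leRHS]div1r ler_pdivlMr; [have := sqr_ge0 x; nra | lra].
Qed.

(** Bernoulli at exponent [- n] bounds the inverse of the left side below by [1 - y], where
    [y = n x]; and [(1 - y) (1 + y + 2 y^2) = 1 + y^2 (1 - 2 y)] is at least 1 when [y <= 1/2]. *)
Lemma exprz_le_quadratic x n : `|x| <= 1/2 -> `|n%:~R * x| <= 1/2 ->
  (1 + x) ^ n <= 1 + n%:~R * x + 2 * (n%:~R * x) ^+ 2.
Proof.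
move=> hx hn; have := bernoulli_exprz x (- n) hx.
rewrite mulrNz mulNr -invr_expz.
have : 0 < (1 + x) ^ n by apply: exprz_gt0; move: hx; rewrite ler_norml; lra.
move: hn; set y := _ * x; set z := _ ^ n; rewrite ler_norml => /andP[y1 y2] z0.
rewrite -[X in _ <= X]div1r ler_pdivlMr // => h.
rewrite -(@ler_pM2l _ (1 - y)); last by lra.
have := sqr_ge0 y; nra.
Qed.

(** The two one-sided bounds above squeeze the power. The error is quadratic in [p * u], uniformly
    for exponents up to [3 p], which covers those met at the three roots. *)
Lemma exprz_expansion u p t x m : 0 <= u -> 1 <= p -> p * u <= 1/100 ->
  0 <= t <= 1 -> `|x - t * u| <= 4 * u ^+ 2 -> `|m%:~R| <= 3 * p ->
  `|(1 + x) ^ m - (1 + m%:~R * t * u)| <= 100 * (p * u) ^+ 2.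
Proof.
move=> u0 p1 pu /andP[t0 t1] hx hm.
have u1 : u <= 1/100 by nra.
have xu : `|x| <= 2 * u.
  by move: hx; rewrite !ler_norml; nra.
have x2 : `|x| <= 1/2 by lra.
have mx : `|m%:~R * x| <= 6 * (p * u).
  rewrite normrM; have := ler_pM (normr_ge0 m%:~R) (normr_ge0 x) hm xu; nra.
have mx2 : `|m%:~R * x| <= 1/2 by lra.
have d : `|m%:~R * (x - t * u)| <= 12 * (p * u) ^+ 2.
  rewrite normrM; apply: (le_trans (ler_pM (normr_ge0 _) (normr_ge0 _) hm hx)).
  have -> : 3 * p * (4 * u ^+ 2) = 12 * (p * u ^+ 2) by ring.
  rewrite exprMn; have := sqr_ge0 u; nra.
have h1 := bernoulli_exprz x m x2.
have h2 := exprz_le_quadratic x m x2 mx2.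
have sq : (m%:~R * x) ^+ 2 <= 36 * (p * u) ^+ 2.
  by move: mx; rewrite ler_norml; nra.
move: d; rewrite mulrBr !ler_norml; lra.
Qed.

(** The expansions of both factors are multiplied; every cross term is at most a constant times
    [(q u)^2]. The first conjunct records the smallness of the linear term, as [root_expansion]
    requires. *)
Lemma exprz_prod_expansion u q t s x y m n : 0 <= u -> 1 <= q -> q * u <= 1/1000 ->
  0 <= t <= 1 -> 0 <= s <= 1 ->
  `|x - t * u| <= 4 * u ^+ 2 -> `|y - s * u| <= 4 * u ^+ 2 ->
  `|m%:~R| <= 3 * q -> `|n%:~R| <= 3 * q ->
  `|(m%:~R * t + n%:~R * s) * u| <= 6 * (q * u) /\
  `|(1 + x) ^ m * (1 + y) ^ n - (1 + (m%:~R * t + n%:~R * s) * u)| <= 300 * (q * u) ^+ 2.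
Proof.
move=> u0 q1 qu t01 s01 hx hy hm hn.
have qu' : q * u <= 1/100 by lra.
have ex := exprz_expansion u q t x m u0 q1 qu' t01 hx hm.
have ey := exprz_expansion u q s y n u0 q1 qu' s01 hy hn.
have bnd (j : int) (r : R) : `|j%:~R| <= 3 * q -> 0 <= r <= 1 ->
    `|j%:~R * r * u| <= 3 * (q * u).
  move=> hj /andP[r0 r1]; rewrite !normrM (ger0_norm r0) (ger0_norm u0) mulrA.
  apply: ler_wpM2r => //; apply: le_trans hj.
  by rewrite ler_piMr.
have bm := bnd m t hm t01; have bn := bnd n s hn s01.
have v0 : 0 <= q * u by apply: mulr_ge0 => //; lra.
rewrite mulrDl; move: ex ey bm bn v0 qu'.
move: (m%:~R * t * u) (n%:~R * s * u) (q * u) => a b v; clear.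
set X := _ ^ m; set Y := _ ^ n => ex ey bm bn v0 v1; split.
  by apply: (le_trans (ler_normD _ _)); lra.
set d := X - _ in ex; set d' := Y - _ in ey.
have -> : X * Y - (1 + (a + b)) = d + d' + (a * b + (a * d' + b * d + d * d')).
  by rewrite /d /d'; ring.
move: d d' ex ey => d d'; clear X Y => ex ey.
have V2 : v ^+ 2 <= v / 100 by have := ler_wpM2r v0 v1; lra.
have dv : `|d| <= 1 * v by lra.
have d'v : `|d'| <= 1 * v by lra.
have mul2 (c e C E : R) : `|c| <= C * v -> `|e| <= E * v -> `|c * e| <= C * E * v ^+ 2.
  move=> h1 h2; rewrite normrM.
  apply: (le_trans (ler_pM (normr_ge0 _) (normr_ge0 _) h1 h2)).
  by rewrite expr2 mulrACA.
have e1 := mul2 _ _ 3 3 bm bn.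
have e2 := mul2 _ _ 3 1 bm d'v.
have e3 := mul2 _ _ 3 1 bn dv.
have e4 := mul2 _ _ 1 1 dv d'v.
have := sqr_ge0 v; move: ex ey e1 e2 e3 e4.
by rewrite !ler_norml; clear; lra.
Qed.

(** The root is compared with [1 + c - 1000 z] and [1 + c + 1000 z], where [z = p u^2], through
    their [p]-th powers. Taking the root divides the error by [p], whence [p u^2] instead of
    [p^2 u^2]. *)
Lemma root_expansion (p : nat) u k w : (0 < p)%N -> 0 <= u -> p%:R * u <= 1/1000 ->
  `|k * u| <= 6 * (p%:R * u) -> 0 < w ->
  `|w ^+ p - (1 + k * u)| <= 300 * (p%:R * u) ^+ 2 ->
  `|w - (1 + k / p%:R * u)| <= 1000 * p%:R * u ^+ 2.
Proof.
move=> p0 u0 pu hk w0 hW.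
have P1 : 1 <= p%:R :> R by rewrite ler1n.
have pne : p%:R != 0 :> R by rewrite pnatr_eq0 -lt0n.
set c := k / p%:R * u.
have ck : p%:R * c = k * u by rewrite /c; field.
set z := p%:R * u ^+ 2.
have z0 : 0 <= z by rewrite mulr_ge0 // sqr_ge0.
have zu : z <= u / 1000 by rewrite /z expr2 mulrA; have := ler_wpM2r u0 pu; lra.
have cu : `|c| <= 6 * u.
  rewrite -(@ler_pM2l _ p%:R); last by rewrite ltr0n.
  have -> : p%:R * `|c| = `|k * u| by rewrite -ck (normrM p%:R c) normr_nat.
  by rewrite mulrCA.
have u1 : u <= 1/1000 by have := ler_wpM2r u0 P1; lra.
have v2 : (p%:R * u) ^+ 2 = p%:R * z by rewrite /z; ring.
rewrite -mulrA -/z ler_distl; rewrite v2 -ck in hW.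
move: cu; rewrite ler_norml => /andP[c1 c2].
move: hW; rewrite ler_norml => /andP[hW1 hW2].
have pz0 : 0 <= p%:R * z by rewrite mulr_ge0.
clearbody c; clear k hk ck.
apply/andP; split.
  (* In the [p]-th power of the lower candidate the quadratic term costs at most [98 p z]; the shift
     [1000 p z] absorbs it together with the error [300 p z] of the hypothesis. *)
  set a := c - 1000 * z.
  have au : `|a| <= 7 * u by rewrite /a ler_norml; clear -c1 c2 z0 zu; lra.
  have a1 : `|a| <= 1 / 2 by clear -au u1; lra.
  have -> : 1 + c - 1000 * z = 1 + a by rewrite /a; ring.
  rewrite -(@ler_pXn2r _ p) ?nnegrE //; last 2 first.
  - by move: a1; rewrite ler_norml; clear; lra.
  - exact: ltW.
  have pa : `|p%:R * a| <= 7 * (p%:R * u).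
    rewrite normrM normr_nat; have := ler_wpM2l (ler0n R p) au.
    by rewrite [in X in _ -> X]mulrCA.
  have := exprz_le_quadratic a p%:Z a1.
  rewrite -pmulrn -exprnP => h.
  apply: (le_trans (h _)); first by clear -pa pu; lra.
  have q2 : (p%:R * a) ^+ 2 <= 49 * (p%:R * z).
    rewrite -v2 -(@real_normK _ (p%:R * a)) ?num_real //.
    have := ler_pM (normr_ge0 _) (normr_ge0 _) pa pa.
    by rewrite -!expr2; clear; lra.
  move: q2 hW1 pz0; set Q := (_ * _) ^+ 2.
  have -> : p%:R * a = p%:R * c - 1000 * (p%:R * z) by rewrite /a; ring.
  by clear; lra.
(* For the upper candidate Bernoulli's inequality alone suffices. *)
set a := c + 1000 * z.
have au : `|a| <= 1 / 2 by rewrite /a ler_norml; clear -c1 c2 z0 zu u1 u0; lra.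
have -> : 1 + c + 1000 * z = 1 + a by rewrite /a; ring.
rewrite -(@ler_pXn2r _ p) ?nnegrE //; last 2 first.
- exact: ltW.
- by move: au; rewrite ler_norml; clear; lra.
have := bernoulli_exprz a p%:Z au.
rewrite -exprnP -pmulrn => h; apply: le_trans h.
have -> : p%:R * a = p%:R * c + 1000 * (p%:R * z) by rewrite /a; ring.
by clear -hW2 pz0; lra.
Qed.

Lemma pexpansion_root (p : nat) u t s x y m n w : (0 < p)%N ->
  0 <= u -> p%:R * u <= 1/1000 -> 0 <= t <= 1 -> 0 <= s <= 1 ->
  `|x - t * u| <= 4 * u ^+ 2 -> `|y - s * u| <= 4 * u ^+ 2 ->
  (`|m| <= 3 * p)%N -> (`|n| <= 3 * p)%N ->
  0 < w -> w ^+ p = (1 + x) ^ m * (1 + y) ^ n ->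
  `|w - (1 + (m%:~R * t + n%:~R * s) / p%:R * u)| <= 1000 * p%:R * u ^+ 2.
Proof.
move=> p0 u0 pu t01 s01 hx hy hm hn w0 hw.
have P1 : 1 <= p%:R :> R by rewrite ler1n.
have cast k : (`|k| <= 3 * p)%N -> `|k%:~R| <= 3 * p%:R :> R.
  by rewrite -intr_norm -abszE -natrM pmulrn ler_nat.
have [hk hW] := exprz_prod_expansion u p%:R t s x y m n u0 P1 pu t01 s01 hx hy
  (cast _ hm) (cast _ hn).
by apply: root_expansion; rewrite // hw.
Qed.

End Estimates.

(** * Size of the conjugates of radicals of e^I (e-1)^J *)

Section Places.
Local Open Scope ring_scope.
Variables (R : realFieldType) (p : nat) (lam : R).
Hypotheses (p_gt0 : (0 < p)%N) (lam_ge : 10000 * p%:R ^+ 3 <= lam).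
Local Notation l := (lam ^+ p).
Local Notation u := (l^-1).
Implicit Types (I J : int) (X y : R).

Let p1 : 1 <= p%:R :> R. Proof. by rewrite ler1n. Qed.

Lemma lam_ge_p : 10000 * p%:R <= lam.
Proof.
apply: le_trans lam_ge; rewrite ler_pM2l // exprS ler_peMr //.
by rewrite exprn_ege1.
Qed.

Lemma lam_gt0 : 0 < lam.
Proof. by apply: lt_le_trans lam_ge_p; rewrite mulr_gt0 // ltr0n. Qed.

Lemma expr_lam_ge : lam <= l.
Proof.
rewrite -(prednK p_gt0) exprS ler_peMr ?(ltW lam_gt0) // exprn_ege1 //.
by have := lam_ge_p; have := p1; lra.
Qed.

Lemma u_gt0 : 0 < u.
Proof. by rewrite invr_gt0 exprn_gt0 // lam_gt0. Qed.

Lemma lam_u : lam * u <= 1.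
Proof. by rewrite ler_pdivrMr ?mul1r ?expr_lam_ge // exprn_gt0 // lam_gt0. Qed.

Lemma pu_le : p%:R * u <= 1 / 1000.
Proof.
have := lam_u; have := u_gt0; move: lam_ge_p.
set v := u; set q := p%:R; nra.
Qed.

Lemma u_le : u <= 1 / 1000.
Proof. by have := pu_le; have := u_gt0; move: p1; set v := u; nra. Qed.

Let lu : l * u = 1.
Proof. by rewrite divff // expf_neq0 // gt_eqF // lam_gt0. Qed.

(* [X] has size [lam ^ e] and relative second order term [k / (p l)]. *)
Definition main_expansion (X : R) (e k : int) :=
  exists2 w, X = lam ^ e * w & `|w - (1 + k%:~R / p%:R * u)| <= 1000 * p%:R * u ^+ 2.

(** All three roots reduce to this: after division by [lam ^ e], whose [p]-th power is [l ^ e], what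
    remains is a [p]-th root of a product of two factors near 1. *)
Let expansionP (e k m n : int) (t s x y X : R) :
  0 <= t <= 1 -> 0 <= s <= 1 ->
  `|x - t * u| <= 4 * u ^+ 2 -> `|y - s * u| <= 4 * u ^+ 2 ->
  (`|m| <= 3 * p)%N -> (`|n| <= 3 * p)%N ->
  k%:~R = m%:~R * t + n%:~R * s :> R ->
  0 < X -> X ^+ p = l ^ e * ((1 + x) ^ m * (1 + y) ^ n) ->
  main_expansion X e k.
Proof.
move=> ht hs hx hy hm hn hk X0 XE.
have le0 : lam ^ e != 0 by rewrite expfz_neq0 // gt_eqF // lam_gt0.
exists (X / lam ^ e); first by rewrite mulrC divfK.
rewrite hk; apply: (@pexpansion_root R p u t s x y m n) => //.
- exact: ltW u_gt0.
- exact: pu_le.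
- by rewrite divr_gt0 // exprz_gt0 // lam_gt0.
have le : (lam ^ e) ^+ p = l ^ e by rewrite !exprnP exprzAC.
by rewrite exprMn XE exprVn le mulrC mulKf // -le expf_neq0.
Qed.

(** At the root [- y] near 0 the equation gives [y = (l (1 - y/l) (1 + y))^-1]. Here [1 - y/l] is 1
    up to [O(l^-2)] and [1 + y] is [1 + 1/l] up to [O(l^-2)], so only the total exponent [J - I] of
    [1 + y] enters. *)
Lemma place1_expansion I J X y : (`|I| <= p)%N -> (`|J| <= p)%N ->
  0 <= y <= u -> y * (1 + y) * (l - y) = 1 ->
  0 < X -> X ^+ p = y ^ I * (1 + y) ^ J -> main_expansion X (- I) (J - I).
Proof.
move=> hI hJ /andP[y0 yu] ye X0 XE.
move: yu u_gt0 u_le lu; set v := u => yu v0 v1 lv.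
have yv0 : 0 <= y * v by rewrite mulr_ge0 // ltW.
have yv : y * v <= v ^+ 2 by rewrite expr2 ler_wpM2r // ltW.
have v2 : v ^+ 2 <= v / 1000 by have := ler_wpM2r (ltW v0) v1; lra.
have v20 := sqr_ge0 v.
have ylow : v - v ^+ 2 <= y.
  have e : y * ((1 + y) * (1 - y * v)) = v.
    have -> : y * ((1 + y) * (1 - y * v)) = y * (1 + y) * (l * v - y * v).
      by rewrite lv mulrA.
    by rewrite -mulrBl mulrA ye mul1r.
  have h : (1 + y) * (1 - y * v) <= 1 + v.
    have : 0 <= y * (y * v) by rewrite mulr_ge0.
    by lra.
  have : v <= y * (1 + v) by rewrite -{1}e; apply: ler_wpM2l.
  by lra.
apply: (@expansionP _ _ (- I) (J - I) 0 1 (- (y * v)) y); rewrite ?lexx ?ler01 //.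
- by rewrite mul0r subr0 normrN ger0_norm -/v; lra.
- by rewrite mul1r ler_norml -/v; have := sqr_ge0 v; lra.
- by clear -hI hJ; lia.
- by clear -hI hJ; lia.
- by rewrite mulr0 add0r mulr1.
have yn : y != 0 by apply: contra_eqN ye => /eqP->; rewrite !mul0r eq_sym oner_eq0.
have y1n : 1 + y != 0 by lra.
have yvn : 1 - y * v != 0.
  by lra.
have ly : y = (l * (1 - y * v) * (1 + y))^-1.
  rewrite mulrBr mulr1 (mulrCA l y) lv mulr1.
  have zn : (l - y) * (1 + y) != 0.
    apply: contra_eqN ye => /eqP h.
    by rewrite -mulrA (mulrC (1 + y)) h mulr0 eq_sym oner_eq0.
  by apply: (mulIf zn); rewrite mulVf // -[RHS]ye; ring.
by rewrite XE {1}ly exprz_inv !expfzMl expfzDr //; ring.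
Qed.

(** At the root [1 + y] the equation gives [y = (l (1 + (1 + y)/l) (1 + y))^-1]. Both factors are
    [1 + 1/l] to first order, with exponents [- J] and [I - J], which add up to [I - 2 J]. *)
Lemma place2_expansion I J X y : (`|I| <= p)%N -> (`|J| <= p)%N ->
  0 <= y <= u -> (1 + y) * y * (l + 1 + y) = 1 ->
  0 < X -> X ^+ p = (1 + y) ^ I * y ^ J -> main_expansion X (- J) (I - J *+ 2).
Proof.
move=> hI hJ /andP[y0 yu] ye X0 XE.
move: yu u_gt0 u_le lu; set v := u => yu v0 v1 lv.
have yv0 : 0 <= y * v by rewrite mulr_ge0 // ltW.
have yv : y * v <= v ^+ 2 by rewrite expr2 ler_wpM2r // ltW.
have v2 : v ^+ 2 <= v / 1000 by have := ler_wpM2r (ltW v0) v1; lra.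
have v20 := sqr_ge0 v.
have e : y * ((1 + y) * (1 + (1 + y) * v)) = v.
  have -> : y * ((1 + y) * (1 + (1 + y) * v)) =
      (1 + y) * y * (l * v + (1 + y) * v) by rewrite lv; ring.
  by rewrite -mulrDl mulrA addrA ye mul1r.
have ylow : v - 4 * v ^+ 2 <= y.
  have h1 : (1 + y) * (1 + (1 + y) * v) <= 1 + 4 * v.
    by have := ler_wpM2r yv0 yu; have := ler_wpM2r (ltW v0) v2;
      have := ler_wpM2l (ltW v0) yv; lra.
  have : v <= y * (1 + 4 * v) by rewrite -{1}e; apply: ler_wpM2l.
  by lra.
apply: (@expansionP _ _ (- J) (I - J) 1 1 ((1 + y) * v) y); rewrite ?lexx ?ler01 //.
- by rewrite mul1r ger0_norm -/v; lra.
- by rewrite mul1r ler_norml -/v; have := sqr_ge0 v; lra.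
- by clear -hI hJ; lia.
- by clear -hI hJ; lia.
- by rewrite !mulr1 -rmorphD /=; congr (_%:~R); clear; lia.
have yn : y != 0 by apply: contra_eqN ye => /eqP->; rewrite !(mul0r, mulr0) eq_sym oner_eq0.
have y1n : 1 + y != 0 by lra.
have ly : y = (l * (1 + (1 + y) * v) * (1 + y))^-1.
  have -> : l * (1 + (1 + y) * v) = l + 1 + y.
    by rewrite [LHS]mulrDr mulrCA lv !mulr1 addrA.
  have zn : (l + 1 + y) * (1 + y) != 0.
    apply: contra_eqN ye => /eqP h.
    by rewrite -mulrA mulrCA (mulrC (1 + y)) h mulr0 eq_sym oner_eq0.
  by apply: (mulIf zn); rewrite mulVf // -[RHS]ye; ring.
by rewrite XE {2}ly exprz_inv !expfzMl expfzDr //; ring.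
Qed.

(** At the root [y - l] the absolute values are [l - y = l (1 - y/l)] and
    [l + 1 - y = l (1 + (1 - y)/l)]; only the second contributes at relative order [1/l]. *)
Lemma place3_expansion I J X y : (`|I| <= p)%N -> (`|J| <= p)%N ->
  0 <= y <= u ->
  0 < X -> X ^+ p = (l - y) ^ I * (l + 1 - y) ^ J -> main_expansion X (I + J) J.
Proof.
move=> hI hJ /andP[y0 yu] X0 XE.
move: yu u_gt0 u_le lu; set v := u => yu v0 v1 lv.
have yv0 : 0 <= y * v by rewrite mulr_ge0 // ltW.
have yv : y * v <= v ^+ 2 by rewrite expr2 ler_wpM2r // ltW.
have v2 : v ^+ 2 <= v / 1000 by have := ler_wpM2r (ltW v0) v1; lra.
have v20 := sqr_ge0 v.
apply: (@expansionP _ _ I J 0 1 (- (y * v)) ((1 - y) * v)); rewrite ?lexx ?ler01 //.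
- by rewrite mul0r subr0 normrN ger0_norm -/v; lra.
- have -> : (1 - y) * v - 1 * u = - (y * v) by rewrite -/v; ring.
  by rewrite normrN ger0_norm -/v; lra.
- by clear -hI hJ; lia.
- by clear -hI hJ; lia.
- by rewrite mulr0 add0r mulr1.
rewrite XE expfzDr; last by rewrite gt_eqF // exprn_gt0 // lam_gt0.
have -> : l - y = l * (1 - y * v) by rewrite mulrBr mulrCA lv !mulr1.
have -> : l + 1 - y = l * (1 + (1 - y) * v) by rewrite mulrDr mulrCA lv !mulr1 addrA.
by rewrite !expfzMl mulrACA.
Qed.

End Places.

(** * Traces that are not integers *)

Section Contradictions.
Local Open Scope ring_scope.
Variable R : realFieldType.

(** Horner's scheme: once the partial value [q] has absolute value at least 1,
    [|q x + c| >= x - B >= 1]. *)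
Lemma int_poly_ge1 (B x : R) (Q : {poly int}) : Q != 0 ->
  (forall i, `|(Q`_i)%:~R| <= B) -> B + 1 <= x ->
  1 <= `|(map_poly intr Q).[x]|.
Proof.
move=> + + xB; have norm1 (z : int) : z != 0 -> 1 <= `|z%:~R : R|.
  by move=> z0; rewrite -intr_norm ler1z -gtz0_ge1 normr_gt0.
elim/poly_ind: Q => [|Q c IH]; first by rewrite eqxx.
have [-> | Q0] := eqVneq Q 0.
  rewrite mul0r add0r => c0 _; rewrite map_polyC hornerC.
  by apply: norm1; apply: contra c0 => /eqP ->; rewrite polyC0.
move=> _ hB.
have hQ i : `|(Q`_i)%:~R| <= B.
  by have := hB i.+1; rewrite coefD coefMX coefC addr0.
have hc : `|c%:~R| <= B by have := hB 0; rewrite coefD coefMX coefC add0r.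
have := IH Q0 hQ; rewrite rmorphD rmorphM /= map_polyX map_polyC !hornerE /=.
set q := _.[x] => q1; have x1 : 1 <= x by have := normr_ge0 (c%:~R : R); lra.
have : `|q * x| <= `|q * x + c%:~R| + `|c%:~R|.
  by rewrite -{1}(addrK c%:~R (q * x)) ler_normB.
rewrite normrM (ger0_norm (le_trans ler01 x1)).
have := ler_peMl (le_trans ler01 x1) q1; lra.
Qed.

Lemma intr_small_eq0 (z : int) : `|z%:~R : R| < 1 -> z = 0.
Proof. by rewrite -intr_norm ltrz1 -[1]/(1%:Z) => h; apply/eqP; lia. Qed.

Lemma small_combination (M a b c d s t : R) : `|M| <= 2000 * s ->
  `|a| <= 4 * t -> `|b| <= 4 * t -> `|c| <= 4 * t -> `|d| <= 4 * t ->
  s <= 1 / 10000 -> t <= 1 / 10000 -> `|M + a + b - c - d| < 1.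
Proof. by rewrite !ler_norml ltr_norml; lra. Qed.

Variables (p : nat) (lam : R).
Hypotheses (p_gt0 : (0 < p)%N) (lam_ge : 10000 * p%:R ^+ 3 <= lam).
Local Notation l := (lam ^+ p).
Local Notation u := (l^-1).
Local Notation expansion := (main_expansion R p lam).

Let p1 : 1 <= p%:R :> R. Proof. by rewrite ler1n. Qed.
Let lam0 : 0 < lam := lam_gt0 R p lam p_gt0 lam_ge.
Let lu : l * u = 1. Proof. by rewrite divff // expf_neq0 // gt_eqF. Qed.
Let ug0 : 0 < u := u_gt0 R p lam p_gt0 lam_ge.
Let lam_p2 : 10000 * p%:R ^+ 2 <= lam.
Proof.
apply: le_trans lam_ge; rewrite ler_pM2l // [leRHS]exprSr ler_peMr //.
by rewrite exprn_ge0.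
Qed.
Let lam_inv : p%:R ^+ 2 * lam^-1 <= 1 / 10000.
Proof. by rewrite ler_pdivrMr //; move: lam_p2; lra. Qed.
Let lam_inv' : p%:R * lam^-1 <= 1 / 10000.
Proof.
apply: le_trans lam_inv; rewrite ler_wpM2r ?invr_ge0 ?(ltW lam0) //.
by rewrite expr2 ler_peMr.
Qed.

Let u_lam : u <= lam^-1.
Proof.
by rewrite lef_pV2 ?posrE ?exprn_gt0 // (expr_lam_ge R p lam p_gt0 lam_ge).
Qed.

Let small_factor (k : int) (w : R) : (`|k| <= 3 * p)%N ->
  `|w - (1 + k%:~R / p%:R * u)| <= 1000 * p%:R * u ^+ 2 -> `|w - 1| <= 4 * u.
Proof.
move=> hk hw.
have h1 : `|k%:~R / p%:R * u| <= 3 * u.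
  rewrite normrM (ger0_norm (ltW ug0)) ler_wpM2r ?(ltW ug0) //.
  rewrite normrM normfV normr_nat ler_pdivrMr ?ltr0n //.
  by rewrite -intr_norm -abszE -natrM pmulrn ler_nat.
have h2 : 1000 * p%:R * u ^+ 2 <= u.
  have := ler_wpM2r (ltW ug0) (pu_le R p lam p_gt0 lam_ge).
  by rewrite expr2; set v := u; lra.
have -> : w - 1 = (w - (1 + k%:~R / p%:R * u)) + k%:~R / p%:R * u by ring.
by apply: (le_trans (ler_normD _ _)); lra.
Qed.

Let lam_neg (e : nat) : (0 < e)%N -> 0 <= lam ^ (- e%:Z) <= lam^-1.
Proof.
move=> e0; rewrite exprz_ge0 ?(ltW lam0) //= -exprnN.
rewrite lef_pV2 ?posrE ?exprn_gt0 // -(prednK e0) exprS ler_peMr ?(ltW lam0) //.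
rewrite exprn_ege1 //; apply: le_trans (lam_ge_p _ _ _ p_gt0 lam_ge).
by have := p1; lra.
Qed.

Let small_conj (e : nat) (k : int) (X : R) : (0 < e)%N -> (`|k| <= 3 * p)%N ->
  expansion X (- e%:Z) k -> `|X| <= 2 * lam^-1.
Proof.
move=> e0 hk [w -> hw]; have := small_factor k w hk hw.
have /andP[a0 a1] := lam_neg e e0; have := u_le R p lam p_gt0 lam_ge.
move=> u1 hw1; rewrite normrM (ger0_norm a0) mulrC.
apply: ler_pM => //.
move: hw1; rewrite !ler_norml; lra.
Qed.

(** Multiplying by [p l] turns a conjugate of size [lam ^ (- e)] into a term of an integer
    polynomial in [lam], with an error of order [p / lam]. *)
Let conj_term (e : nat) (k : int) (X : R) (b : bool) : (0 < e < p)%N ->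
  (`|k| <= 3 * p)%N -> expansion X (- e%:Z) k ->
  exists2 d, p%:R * l * ((-1) ^+ b * X) = p%:R * ((-1) ^+ b * lam ^+ (p - e)) + d
           & `|d| <= 4 * p%:R * lam^-1.
Proof.
move=> /andP[e0 ep] hk [w -> hw]; have := small_factor k w hk hw => hw1.
have /andP[a0 a1] := lam_neg e e0.
have lE : l * lam ^ (- e%:Z) = lam ^+ (p - e).
  by rewrite -{1}(subnK (ltnW ep)) exprD -mulrA -exprnN divff ?mulr1 // expf_neq0 ?gt_eqF.
exists ((-1) ^+ b * (p%:R * (l * lam ^ (- e%:Z) * (w - 1)))).
  by rewrite -lE; ring.
rewrite normrM normrX normrN1 expr1n mul1r normrM normr_nat.
have -> : 4 * p%:R * lam^-1 = p%:R * (4 * lam^-1) by ring.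
apply: ler_wpM2l => //.
have l0 : 0 <= l by rewrite exprn_ge0 // ltW.
rewrite !normrM (ger0_norm a0) (ger0_norm l0).
apply: (@le_trans _ _ (l * lam^-1 * (4 * u))).
  by apply: ler_pM => //; [rewrite mulr_ge0 | rewrite ler_wpM2l].
have -> : l * lam^-1 * (4 * u) = l * u * (4 * lam^-1) by ring.
by rewrite lu mul1r.
Qed.

(* If the trace is [l + k/p] up to a quantity smaller than [1/p], it can only be
   an integer when [p] divides [k]. *)
Lemma dominant_trace_dvd (L z k k2 k3 : int) (e2 e3 : nat) (X1 X2 X3 : R) :
  l = L%:~R -> (0 < e2)%N -> (0 < e3)%N ->
  (`|k2| <= 3 * p)%N -> (`|k3| <= 3 * p)%N ->
  expansion X1 p%:Z k -> expansion X2 (- e2%:Z) k2 -> expansion X3 (- e3%:Z) k3 ->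
  forall s2 s3 : R, `|s2| = 1 -> `|s3| = 1 ->
  z%:~R = X1 + s2 * X2 + s3 * X3 -> (p%:Z %| k)%Z.
Proof.
move=> lL e20 e30 hk2 hk3 [w1 X1E hw1] h2 h3 s2 s3 n2 n3 zE.
have b2 : `|s2 * X2| <= 2 * lam^-1 by rewrite normrM n2 mul1r (small_conj _ _ _ e20 hk2).
have b3 : `|s3 * X3| <= 2 * lam^-1 by rewrite normrM n3 mul1r (small_conj _ _ _ e30 hk3).
set r := w1 - _ in hw1.
have w1E : w1 = 1 + k%:~R / p%:R * u + r by rewrite /r; ring.
have pn : p%:R != 0 :> R by rewrite pnatr_eq0 -lt0n.
(* [p] times the trace differs from the integer [p L + k] by a remainder of order [p^2 / lam]; this
   integer difference is below 1 in absolute value and so vanishes. *)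
have zE' : p%:R * z%:~R - p%:R * L%:~R - k%:~R =
    p%:R * (l * r + s2 * X2 + s3 * X3) :> R.
  rewrite zE X1E -exprnP -lL w1E.
  have -> : l * (1 + k%:~R / p%:R * u + r) = l + k%:~R / p%:R * (l * u) + l * r.
    by ring.
  by rewrite lu; field.
have br : `|l * r| <= 1000 * p%:R * lam^-1.
  have l0 : 0 <= l by rewrite exprn_ge0 // ltW.
  rewrite normrM (ger0_norm l0).
  apply: (le_trans (ler_wpM2l l0 hw1)).
  have -> : l * (1000 * p%:R * u ^+ 2) = (l * u) * (1000 * p%:R) * u by ring.
  by rewrite lu mul1r ler_wpM2l // mulr_ge0.
have small : `|p%:R * z%:~R - p%:R * L%:~R - k%:~R : R| < 1.
  rewrite zE' normrM normr_nat.
  have h : `|l * r + s2 * X2 + s3 * X3| <= 1004 * p%:R * lam^-1.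
    have h4 : 4 * lam^-1 <= 4 * p%:R * lam^-1.
      by rewrite ler_wpM2r ?invr_ge0 ?(ltW lam0) // ler_peMr.
    apply: (le_trans (ler_normD _ _)); apply: (le_trans (lerD (ler_normD _ _) b3)).
    by move: br b2 h4; lra.
  apply: (le_lt_trans (ler_wpM2l _ h)); first exact: ler0n.
  by have := lam_inv; lra.
have : p%:Z * z - p%:Z * L - k = 0.
  by apply: intr_small_eq0; rewrite !rmorphB !rmorphM /= -pmulrn.
by move=> h; apply/dvdzP; exists (z - L); clear -h; lia.
Qed.

(** The dominant terms, both of size [lam ^ (p - 1)], cancel up to order [1 / lam], so the integer
    [z] would be 0. Multiplication by [p l] then yields a nonzero integer polynomial in [lam] whose
    value is too small. *)
Lemma dominant_traces_differ (z k k' k2 k3 k4 k5 : int) (e2 e3 e4 e5 : nat)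
    (X1 X2 X3 Y1 Y2 Y3 : R) :
  (0 < e2 < p)%N -> (0 < e3 < p)%N -> (0 < e4 < p)%N -> (0 < e5 < p)%N ->
  (`|k2| <= 3 * p)%N -> (`|k3| <= 3 * p)%N ->
  (`|k4| <= 3 * p)%N -> (`|k5| <= 3 * p)%N ->
  (0 < `|k - k'| < 2 * p)%N ->
  expansion X1 p.-1%:Z k -> expansion X2 (- e2%:Z) k2 -> expansion X3 (- e3%:Z) k3 ->
  expansion Y1 p.-1%:Z k' -> expansion Y2 (- e4%:Z) k4 -> expansion Y3 (- e5%:Z) k5 ->
  forall b2 b3 b4 b5 : bool,
  z%:~R <> X1 + (-1) ^+ b2 * X2 + (-1) ^+ b3 * X3 -
           (Y1 + (-1) ^+ b4 * Y2 + (-1) ^+ b5 * Y3).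
Proof.
move=> he2 he3 he4 he5 hk2 hk3 hk4 hk5 hkk [w1 -> hw1] h2 h3 [v1 -> hv1] h4 h5.
move=> b2 b3 b4 b5 zE.
have pn : p%:R != 0 :> R by rewrite pnatr_eq0 -lt0n.
set K := k - k' in hkk.
pose r := w1 - v1 - K%:~R / p%:R * u.
have hr : `|r| <= 2000 * p%:R * u ^+ 2.
  have -> : r = w1 - (1 + k%:~R / p%:R * u) - (v1 - (1 + k'%:~R / p%:R * u)).
    by rewrite /r /K rmorphB /=; ring.
  apply: (le_trans (ler_normB _ _)); apply: (le_trans (lerD hw1 hv1)).
  by lra.
clearbody K.
have wv : w1 - v1 = K%:~R / p%:R * u + r by rewrite /r; ring.
have lE : lam * lam ^+ p.-1 = l by rewrite -exprS prednK.
have lami : lam^-1 = lam ^+ p.-1 * u.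
  by rewrite -lE invfM mulrCA divff ?mulr1 // expf_neq0 // gt_eqF.
have L0 : 0 <= lam ^+ p.-1 by rewrite exprn_ge0 // ltW.
have li0 : 0 <= lam^-1 by rewrite invr_ge0 ltW.
have br : `|lam ^+ p.-1 * r| <= 2000 * (p%:R * u) * lam^-1.
  rewrite normrM (ger0_norm L0); apply: (le_trans (ler_wpM2l L0 hr)).
  by rewrite lami le_eqVlt; apply/orP; left; apply/eqP; ring.
have small e k0 X (b : bool) : (0 < e < p)%N -> (`|k0| <= 3 * p)%N ->
    expansion X (- e%:Z) k0 -> `|(-1) ^+ b * X| <= 2 * lam^-1.
  move=> /andP[e0 _] hk hX.
  by rewrite normrM normrX normrN1 expr1n mul1r (small_conj _ _ _ e0 hk).
have mainE : lam ^ p.-1%:Z * w1 - lam ^ p.-1%:Z * v1 =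
    K%:~R / p%:R * lam^-1 + lam ^+ p.-1 * r.
  by rewrite -mulrBr wv -exprnP lami; ring.
have K2 : `|K%:~R| <= 2 * p%:R :> R.
  rewrite -intr_norm -abszE -natrM pmulrn ler_nat.
  by case/andP: hkk => _ /ltnW.
have z0 : z = 0.
  apply: intr_small_eq0; rewrite zE.
  set a2 := _ * X2; set a3 := _ * X3; set a4 := _ * Y2; set a5 := _ * Y3.
  have s2 : `|a2| <= 2 * lam^-1 by apply: small he2 hk2 h2.
  have s3 : `|a3| <= 2 * lam^-1 by apply: small he3 hk3 h3.
  have s4 : `|a4| <= 2 * lam^-1 by apply: small he4 hk4 h4.
  have s5 : `|a5| <= 2 * lam^-1 by apply: small he5 hk5 h5.
  set A := lam ^ _ * w1 in mainE *; set B := lam ^ _ * v1 in mainE *.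
  have AB : `|A - B| <= 4 * lam^-1.
    rewrite mainE; apply: (le_trans (ler_normD _ _)).
    have t1 : `|K%:~R / p%:R * lam^-1| <= 2 * lam^-1.
      rewrite normrM (ger0_norm li0) ler_wpM2r // normrM normfV normr_nat.
      by rewrite ler_pdivrMr ?ltr0n.
    have t2 : 2000 * (p%:R * u) * lam^-1 <= 2 * lam^-1.
      rewrite ler_wpM2r //; have := pu_le R p lam p_gt0 lam_ge.
      by set v := u; lra.
    by move: br t1 t2; lra.
  have li : lam^-1 <= 1 / 10000.
    by apply: le_trans lam_inv'; rewrite ler_peMl.
  by move: s2 s3 s4 s5 AB li; rewrite !ler_norml ltr_norml; lra.
pose c (b : bool) : int := (-1) ^+ b.
(* [Q] collects the terms of [p l z] that are not small: the second order difference [K] of the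
   dominant terms and the four other conjugates. *)
pose Q : {poly int} := K *: 'X^(p.-1) + p%:Z *:
  (c b2 *: 'X^(p - e2) + c b3 *: 'X^(p - e3)
   - c b4 *: 'X^(p - e4) - c b5 *: 'X^(p - e5)).
have c1 b : c b = 1 \/ c b = - 1 by rewrite /c; case: b; [right | left].
(* A sum of four signs is even, so [Q(1)] is congruent to [K] modulo [2 p], and [0 < |K| < 2 p].
   Evaluation at 1 is insensitive to coincidences among the exponents. *)
have Q0 : Q != 0.
  apply/eqP => /(congr1 (horner^~ 1)).
  rewrite /Q !hornerE !expr1n !mulr1.
  move: hkk (c1 b2) (c1 b3) (c1 b4) (c1 b5); clear.
  move: (c b2) (c b3) (c b4) (c b5) => x y z t.
  by move=> h [] -> [] -> [] -> [] ->; lia.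
have Qlam : (map_poly intr Q).[lam] = K%:~R * lam ^+ p.-1 + p%:R *
  ((-1) ^+ b2 * lam ^+ (p - e2) + (-1) ^+ b3 * lam ^+ (p - e3)
   - (-1) ^+ b4 * lam ^+ (p - e4) - (-1) ^+ b5 * lam ^+ (p - e5)).
  rewrite /Q !(rmorphD, rmorphN) /= !map_polyZ /= !(rmorphD, rmorphN) /=.
  rewrite !map_polyZ /= !map_polyXn !hornerE /c !rmorphXn /= !rmorphN1 -pmulrn.
  by [].
have Qbig : 1 <= `|(map_poly intr Q).[lam]|.
  (* Coefficients are at most [6 p]: less than [2 p] from [K] and at most [4 p] from the four
     signs. *)
  apply: (int_poly_ge1 (6 * p%:R)) => //; last first.
    have := lam_ge_p R p lam p_gt0 lam_ge; have := p1; lra.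
  move=> i; rewrite -intr_norm -abszE -natrM pmulrn ler_nat.
  rewrite /Q !(coefD, coefN, coefZ, coefXn).
  move: hkk (c1 b2) (c1 b3) (c1 b4) (c1 b5); clear.
  move: (c b2) (c b3) (c b4) (c b5) => x y z t.
  set q1 := (_ == p.-1); set S : int := x * _ + _ - _ - _.
  move=> /andP[_ hK] hx hy hz ht.
  have term1 (s : int) (q : bool) : s = 1 \/ s = -1 -> (`|(s * q%:R)%R| <= 1)%N.
    by case=> ->; case: q.
  have S4 : (`|S| <= 4)%N.
    rewrite /S; move: (term1 x (i == (p - e2)%N) hx) (term1 y (i == (p - e3)%N) hy).
    move: (term1 z (i == (p - e4)%N) hz) (term1 t (i == (p - e5)%N) ht).
    by move: (x * _) (y * _) (z * _) (t * _) => A B C D; clear; lia.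
  have h1 : (`|(K * q1%:R)%R| <= 2 * p)%N.
    by case: q1; rewrite ?mulr1 ?mulr0 // ltnW.
  have h2 : (`|(p%:Z * S)%R| <= 4 * p)%N by rewrite abszM mulnC leq_mul2r S4 orbT.
  by move: (K * _) (_ * S) h1 h2 => A B; clear; lia.
have [d2 E2 D2] := conj_term _ _ _ b2 he2 hk2 h2.
have [d3 E3 D3] := conj_term _ _ _ b3 he3 hk3 h3.
have [d4 E4 D4] := conj_term _ _ _ b4 he4 hk4 h4.
have [d5 E5 D5] := conj_term _ _ _ b5 he5 hk5 h5.
(* Since [z = 0], [Q(lam)] is the negative of the collected error terms, which stay below 1. *)
have QE : (map_poly intr Q).[lam] =
    - (p%:R * l * (lam ^+ p.-1 * r) + d2 + d3 - d4 - d5).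
  have : p%:R * l * z%:~R = 0 :> R by rewrite z0 mulr0.
  have ll : l * lam^-1 = lam ^+ p.-1 by rewrite lami mulrCA lu mulr1.
  have E1 : p%:R * l * (lam ^ p.-1%:Z * w1 - lam ^ p.-1%:Z * v1) =
      K%:~R * lam ^+ p.-1 + p%:R * l * (lam ^+ p.-1 * r).
    rewrite mainE mulrDr -ll; congr (_ + _).
    by move: (l) (lam^-1) => T S; field.
  move: E1 E2 E3 E4 E5; rewrite zE Qlam.
  set A := lam ^ _ * w1; set B := lam ^ _ * v1.
  set a2 := _ * X2; set a3 := _ * X3; set a4 := _ * Y2; set a5 := _ * Y3.
  set M := _ * r; set P := K%:~R * _.
  set f2 := _ * lam ^+ (p - e2); set f3 := _ * lam ^+ (p - e3).
  set f4 := _ * lam ^+ (p - e4); set f5 := _ * lam ^+ (p - e5).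
  move: (p%:R * l) => T; lra.
have bM : `|p%:R * l * (lam ^+ p.-1 * r)| <= 2000 * p%:R ^+ 2 * lam^-1.
  rewrite normrM ger0_norm; last by rewrite mulr_ge0 // exprn_ge0 // ltW.
  apply: (le_trans (ler_wpM2l _ br)); first by rewrite mulr_ge0 // exprn_ge0 // ltW.
  have -> : p%:R * l * (2000 * (p%:R * u) * lam^-1) =
    (l * u) * (2000 * p%:R ^+ 2 * lam^-1) by ring.
  by rewrite lu mul1r.
move: Qbig; rewrite QE normrN leNgt => /negP; apply.
apply: (@small_combination _ _ _ _ _ (p%:R ^+ 2 * lam^-1) (p%:R * lam^-1));
  by rewrite ?[leRHS]mulrA //.
Qed.

End Contradictions.

(** * Conjugates in the cubic field *)

Section Conjugates.
Local Open Scope ring_scope.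
Variable l : nat.

Definition ennola_rat : {poly rat} := map_poly intr (ennola_poly l).

Lemma ennola_polyE : ennola_poly l = 'X * ('X - 1) * ('X + l%:R%:P) - 1.
Proof. by rewrite /ennola_poly -!mul_polyC rmorphB /=; ring. Qed.

Lemma map_ennola_rat (F : numFieldType) :
  map_poly ratr ennola_rat = map_poly intr (ennola_poly l) :> {poly F}.
Proof.
rewrite /ennola_rat -map_poly_comp; apply: eq_map_poly => z /=.
by rewrite ratr_int.
Qed.

Lemma map_ennolaE (F : comNzRingType) :
  map_poly intr (ennola_poly l) = 'X * ('X - 1) * ('X + l%:R%:P) - 1 :> {poly F}.
Proof.
rewrite ennola_polyE !(rmorphB, rmorphD, rmorphM) /= map_polyX rmorph1.
by rewrite !rmorph_nat.
Qed.

Definition ennola_root (F : numFieldType) (x : F) :=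
  root (map_poly intr (ennola_poly l)) x.

Lemma ennola_rootE (F : numFieldType) (x : F) :
  ennola_root F x = (x * (x - 1) * (x + l%:R) == 1).
Proof. by rewrite /ennola_root map_ennolaE rootE !hornerE subr_eq0. Qed.

Let size_main : size ('X * ('X - 1) * ('X + l%:R%:P) : {poly rat}) = 4.
Proof.
have n1 : 'X + l%:R%:P != 0 :> {poly rat} by rewrite -size_poly_eq0 size_XaddC.
rewrite size_mul ?mulf_neq0 ?polyX_eq0 ?polyXsubC_eq0 // size_XaddC.
by rewrite size_mul ?polyX_eq0 ?polyXsubC_eq0 // size_polyX size_XsubC.
Qed.

Lemma size_ennola_rat : size ennola_rat = 4.
Proof.
by rewrite /ennola_rat map_ennolaE size_polyDl size_main // size_polyN size_poly1.
Qed.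

Lemma monic_ennola (F : numFieldType) :
  (map_poly intr (ennola_poly l) : {poly F}) \is monic.
Proof.
rewrite -map_ennola_rat map_monic /ennola_rat map_ennolaE monicE.
rewrite lead_coefDl; last by rewrite size_main size_polyN size_poly1.
by rewrite !lead_coefM lead_coefX lead_coefXsubC lead_coefXaddC !mulr1.
Qed.

Lemma ennola_root_Aint (x : algC) : ennola_root algC x -> x \in Aint.
Proof.
move=> hx; apply: (root_monic_Aint hx (monic_ennola _)).
by apply/polyOverP => i; rewrite coef_map /= intr_int.
Qed.

(** A rational root would be an algebraic integer, hence an integer dividing 1; but at [1] and [-1]
    the product [z (z - 1) (z + l)] takes the even values 0 and [2 (l - 1)]. *)
Lemma ennola_irreducible : irreducible_poly ennola_rat.
Proof.
apply: cubic_irreducible => [|x]; first by rewrite size_ennola_rat.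
apply/negP => rx.
have rx' : ennola_root algC (ratr x).
  by rewrite /ennola_root -map_ennola_rat fmorph_root.
have /intrP[z hz] : (ratr x : algC) \in Num.int.
  by apply: Cint_rat_Aint (ennola_root_Aint _ rx'); apply: Crat_rat.
move: rx'; rewrite hz ennola_rootE -[1]/(1%:~R) -[l%:R]/(l%:Z%:~R).
rewrite -rmorphB -rmorphD -!rmorphM /= eqr_int => /eqP h.
have : z = 1 \/ z = -1.
  have : (z %| 1)%Z by apply/dvdzP; exists ((z - 1) * (z + l%:Z)); rewrite mulrC mulrA h.
  by rewrite dvdz1; lia.
by case=> zE; move: h; rewrite zE; lia.
Qed.

(** Elements of the cubic field are handled as values of rational polynomials at a root; the same
    [q] at another root, possibly in another field, gives the conjugate. *)
Definition ev (F : numFieldType) (q : {poly rat}) (x : F) : F :=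
  (map_poly ratr q).[x].

(** [ennola_rat] is irreducible and not coprime to [q], so it divides [q]. This moves algebraic
    relations from [algC] to real fields and back. *)
Lemma ev_transfer (F F' : numFieldType) (q : {poly rat}) (x : F) (y : F') :
  ennola_root F x -> ennola_root F' y -> ev F q x = 0 -> ev F' q y = 0.
Proof.
move=> rx ry qx.
have : ennola_rat %| q.
  apply: contraPT qx; rewrite -irreducible_poly_coprime; last exact: ennola_irreducible.
  rewrite -(coprimep_map (@ratr F)) => /coprimep_root h; apply/eqP; apply: h.
  by rewrite map_ennola_rat.
case/dvdpP => k ->; rewrite /ev rmorphM hornerM /=.
by move/rootP: ry; rewrite -map_ennola_rat => ->; rewrite mulr0.
Qed.

(** The graph of the embedding of the field generated by [e] that sends [e] to [r]; a relation
    avoids choosing a polynomial for each element. *)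
Definition conjugates (F F' : numFieldType) (e : F) (r : F') (x : F) (y : F') :=
  exists2 q, x = ev F q e & y = ev F' q r.

Section ConjTheory.
Variables (F F' : numFieldType) (e : F) (r : F').
Hypotheses (re : ennola_root F e) (rr : ennola_root F' r).
Local Notation cj := (conjugates F F' e r).

Lemma conj_fun x y y' : cj x y -> cj x y' -> y = y'.
Proof.
move=> [q -> ->] [q' h ->]; apply/eqP; rewrite -subr_eq0; apply/eqP.
rewrite /ev -hornerN -hornerD -rmorphN -rmorphD.
apply: (ev_transfer _ _ _ _ _ re rr).
by rewrite /ev !rmorphD !rmorphN !hornerE -/(ev F q e) h subrr.
Qed.

Lemma conj_rat c : cj (ratr c) (ratr c).
Proof. by exists c%:P; rewrite /ev map_polyC hornerC. Qed.

Lemma conj1 : cj 1 1.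
Proof. by have := conj_rat 1; rewrite !rmorph1. Qed.

Lemma conj_gen : cj e r.
Proof. by exists 'X; rewrite /ev map_polyX hornerX. Qed.

Lemma conjB x y x' y' : cj x y -> cj x' y' -> cj (x - x') (y - y').
Proof. by move=> [q -> ->] [q' -> ->]; exists (q - q'); rewrite /ev rmorphB !hornerE. Qed.

Lemma conjN x y : cj x y -> cj (- x) (- y).
Proof. by move=> [q -> ->]; exists (- q); rewrite /ev rmorphN !hornerE. Qed.

Lemma conjM x y x' y' : cj x y -> cj x' y' -> cj (x * x') (y * y').
Proof. by move=> [q -> ->] [q' -> ->]; exists (q * q'); rewrite /ev rmorphM !hornerE. Qed.

Lemma conj_eq0 x y : cj x y -> (x == 0) = (y == 0).
Proof.
move=> [q -> ->]; apply/eqP/eqP => h.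
  exact: (ev_transfer _ _ _ _ _ re rr h).
exact: (ev_transfer _ _ _ _ _ rr re h).
Qed.

(** For nonzero [x], a Bezout relation between [q] and the irreducible polynomial supplies a
    polynomial inverting [q] at both roots at once. *)
Lemma conjV x y : cj x y -> cj x^-1 y^-1.
Proof.
move=> h; have [x0 | xn] := eqVneq x 0.
  have /eqP y0 : y == 0 by rewrite -(conj_eq0 x y h) x0.
  by move: h; rewrite x0 y0 !invr0.
have yn : y != 0 by rewrite -(conj_eq0 x y h).
case: h => q xE yE.
have cq : coprimep ennola_rat q.
  rewrite irreducible_poly_coprime; last exact: ennola_irreducible.
  apply/negP => /dvdpP[k kE]; move: xn; rewrite xE kE /ev rmorphM hornerM /=.
  by move/rootP: re; rewrite -map_ennola_rat => ->; rewrite mulr0 eqxx.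
have [[a b] /= hb] := Bezout_eq1_coprimepP _ _ cq.
have inv (G : numFieldType) (g : G) : ennola_root G g -> ev G b g * ev G q g = 1.
  move=> rg; have := congr1 (fun q => ev G q g) hb.
  rewrite /ev rmorphD !rmorphM rmorph1 !hornerE.
  by move/rootP: rg; rewrite -map_ennola_rat => ->; rewrite mulr0 add0r.
exists b.
  by apply: (mulIf xn); rewrite mulVf // xE inv.
by apply: (mulIf yn); rewrite mulVf // yE inv.
Qed.

Lemma conjX x y n : cj x y -> cj (x ^+ n) (y ^+ n).
Proof.
move=> h; elim: n => [|n IH]; first by rewrite !expr0; exact: conj1.
by rewrite !exprS; apply: conjM.
Qed.

Lemma conjXz x y (n : int) : cj x y -> cj (x ^ n) (y ^ n).
Proof.
move=> h; case: n => n; first exact: conjX.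
by rewrite NegzE -!exprnN; apply: conjV; apply: conjX.
Qed.

End ConjTheory.

(* Trace of q(e), read off the remainder of q modulo the Ennola polynomial;
   1 - l and l^2 + 1 are the traces of e and e^2. *)
Definition trace_rat (q : {poly rat}) : rat :=
  let c := q %% ennola_rat in
  3 * c`_0 + (1 - l%:R) * c`_1 + (l%:R ^+ 2 + 1) * c`_2.

Definition ennola_split (F : numFieldType) (x y z : F) :=
  map_poly intr (ennola_poly l) = ('X - x%:P) * ('X - y%:P) * ('X - z%:P).

Lemma ennola_split_root (F : numFieldType) (x y z t : F) : ennola_split F x y z ->
  ennola_root F t = [|| t == x, t == y | t == z].
Proof.
by move=> h; rewrite /ennola_root h !rootM !root_XsubC orbA.
Qed.

(** Comparing coefficients gives the power sums of the roots. Since [trace_rat] is the same rational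
    number for all splitting fields, integrality found in [algC] can be combined with size estimates
    over a real field. *)
Lemma trace_ratP (F : numFieldType) (x y z : F) q : ennola_split F x y z ->
  ev F q x + ev F q y + ev F q z = ratr (trace_rat q).
Proof.
move=> h.
have h' : 'X^3 - (1 - l%:R) *: 'X^2 - l%:R *: 'X - 1 =
    'X^3 - (x + y + z) *: 'X^2 + (x * y + y * z + z * x) *: 'X - (x * y * z)%:P :> {poly F}.
  transitivity (map_poly intr (ennola_poly l) : {poly F}).
    by rewrite map_ennolaE -!mul_polyC !(rmorphD, rmorphN, rmorphM) /=; ring.
  by rewrite h -!mul_polyC !(rmorphD, rmorphM) /=; ring.
have S1 : x + y + z = 1 - l%:R.
  have := congr1 (fun p : {poly F} => p`_2) h'.
  rewrite /= !coefE /= !(mulr0, mulr1, addr0, subr0, sub0r, add0r, oppr0).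
  by move/oppr_inj.
have S2 : x * y + y * z + z * x = - l%:R.
  have := congr1 (fun p : {poly F} => p`_1) h'.
  by rewrite /= !coefE /= !(mulr0, mulr1, addr0, subr0, sub0r, add0r, oppr0).
pose c := q %% ennola_rat.
have evE t : ennola_root F t -> ev F q t = ratr c`_0 + ratr c`_1 * t + ratr c`_2 * t ^+ 2.
  move=> rt; rewrite /ev {1}(divp_eq q ennola_rat) rmorphD rmorphM /= !hornerE.
  move/rootP: rt; rewrite -map_ennola_rat => ->; rewrite mulr0 add0r -/c.
  have sc : (size (map_poly (@ratr F) c) <= 3)%N.
    have : (size c < size ennola_rat)%N by rewrite ltn_modp -size_poly_eq0 size_ennola_rat.
    by rewrite size_map_poly size_ennola_rat.
  rewrite (horner_coef_wide _ sc) !big_ord_recl big_ord0 /= !coef_map /=.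
  by rewrite /bump /=; ring.
rewrite !evE ?(ennola_split_root _ _ _ _ _ h) ?eqxx ?orbT //.
rewrite /trace_rat -/c !(rmorphD, rmorphN, rmorphM, rmorphXn, rmorph1) /= !ratr_nat.
have sq : x ^+ 2 + y ^+ 2 + z ^+ 2 = l%:R ^+ 2 + 1.
  have -> : x ^+ 2 + y ^+ 2 + z ^+ 2 =
    (x + y + z) ^+ 2 - 2 * (x * y + y * z + z * x) by ring.
  by rewrite S1 S2; ring.
by rewrite -S1 -sq; ring.
Qed.

End Conjugates.

(** * Integrality of traces and norms; the real roots *)

Section Integrality.
Local Open Scope ring_scope.
Variable l : nat.

Lemma ennola_split_roots (F : numFieldType) (x y z : F) :
  ennola_root l F x -> ennola_root l F y -> ennola_root l F z ->
  x != y -> y != z -> z != x -> ennola_split l F x y z.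
Proof.
move=> rx ry rz xy yz zx; rewrite /ennola_split.
rewrite (@all_roots_prod_XsubC _ (map_poly intr (ennola_poly l)) [:: x; y; z]).
- rewrite (monicP (monic_ennola l F)) scale1r !big_cons big_nil mulr1.
  by rewrite mulrA.
- by rewrite -map_ennola_rat size_map_poly size_ennola_rat.
- by apply/and4P.
by rewrite uniq_rootsE /= !inE negb_or xy yz eq_sym zx.
Qed.

Lemma ennola_split_algC : exists x y z : algC, ennola_split l algC x y z.
Proof.
have [rs Ers] := closed_field_poly_normal (map_poly intr (ennola_poly l) : {poly algC}).
move: (Ers); rewrite (monicP (monic_ennola l algC)) scale1r => {}Ers.
have : size rs = 3.
  have := congr1 (fun p : {poly algC} => size p) Ers.
  by rewrite /= size_prod_XsubC -map_ennola_rat size_map_poly size_ennola_rat => -[].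
case: rs Ers => [|x [|y [|z []]]] // Ers _; exists x, y, z.
by rewrite /ennola_split Ers !big_cons big_nil mulr1 mulrA.
Qed.

(** If [P] is the minimal polynomial of the value at [e], then [P \Po q] vanishes at [e], hence at
    [e'], and [P] is monic with integer coefficients. *)
Lemma ev_Aint (e e' : algC) q : ennola_root l algC e -> ennola_root l algC e' ->
  ev algC q e \in Aint -> ev algC q e' \in Aint.
Proof.
move=> re re' qe.
have [P [PE Pm] _] := minCpolyP (ev algC q e).
have evc x : ev algC (P \Po q) x = (map_poly ratr P).[ev algC q x].
  by rewrite /ev map_comp_poly horner_comp.
have h : ev algC (P \Po q) e' = 0.
  apply: (ev_transfer l _ _ _ _ _ re re').
  by rewrite evc -PE; apply/rootP; apply: root_minCpoly.
apply: (@root_monic_Aint (minCpoly (ev algC q e))) => //; last exact: minCpoly_monic.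
by apply/rootP; rewrite PE -evc h.
Qed.

Let ratr_Aint_int (c : rat) : (ratr c : algC) \in Aint -> exists z : int, c = z%:~R.
Proof.
move=> h; have /intrP[z hz] : (ratr c : algC) \in Num.int.
  by apply: Cint_rat_Aint h; apply: Crat_rat.
by exists z; move: hz; rewrite -ratr_int => /fmorph_inj.
Qed.

Lemma trace_int (e : algC) q : ennola_root l algC e -> ev algC q e \in Aint ->
  exists z : int, trace_rat l q = z%:~R.
Proof.
move=> re qe; have [x [y [z h]]] := ennola_split_algC.
apply: ratr_Aint_int; rewrite -(trace_ratP _ _ _ _ _ _ h).
have rt t : [|| t == x, t == y | t == z] -> ev algC q t \in Aint.
  by rewrite -(ennola_split_root _ _ _ _ _ _ h) => rt; apply: ev_Aint re rt qe.
by rewrite !rpredD ?rt ?eqxx ?orbT.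
Qed.

(* Newton's identity for the third elementary symmetric function. *)
Definition norm_rat (q : {poly rat}) : rat :=
  (trace_rat l q ^+ 3 - 3 * trace_rat l q * trace_rat l (q ^+ 2)
   + 2 * trace_rat l (q ^+ 3)) / 6.

Lemma norm_ratP (F : numFieldType) (x y z : F) q : ennola_split l F x y z ->
  ev F q x * ev F q y * ev F q z = ratr (norm_rat q).
Proof.
move=> h; have evX n t : ev F (q ^+ n) t = ev F q t ^+ n.
  by rewrite /ev rmorphXn hornerE.
have := trace_ratP _ _ _ _ _ q h; have := trace_ratP _ _ _ _ _ (q ^+ 2) h.
have := trace_ratP _ _ _ _ _ (q ^+ 3) h; rewrite !evX /norm_rat.
move: (trace_rat l q) (trace_rat l (q ^+ 2)) (trace_rat l (q ^+ 3)) => a b c.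
rewrite !(rmorph_nat, rmorphM, rmorphD, rmorphN, rmorphXn, fmorphV) /= => <- <- <-.
by field.
Qed.

(** The norms of [q] and [q'] are integers, and their product is 1 because the relation between the
    two values transfers to every root. *)
Lemma norm_unit (e : algC) q q' : ennola_root l algC e ->
  ev algC q e \in Aint -> ev algC q' e \in Aint -> ev algC q e * ev algC q' e = 1 ->
  norm_rat q = 1 \/ norm_rat q = -1.
Proof.
move=> re qe qe' qq'; have [x [y [z h]]] := ennola_split_algC.
have rt t : [|| t == x, t == y | t == z] -> ennola_root l algC t.
  by rewrite -(ennola_split_root _ _ _ _ _ _ h).
have int q0 : ev algC q0 e \in Aint -> exists m : int, norm_rat q0 = m%:~R.
  move=> q0e; apply: ratr_Aint_int; rewrite -(norm_ratP _ _ _ _ _ h).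
  by apply: rpredM; [apply: rpredM|]; apply: (ev_Aint e) => //; apply: rt;
    rewrite eqxx ?orbT.
have [m mE] := int q qe; have [m' mE'] := int q' qe'.
have one t : ennola_root l algC t -> ev algC q t * ev algC q' t = 1.
  move=> rt0; apply/eqP; rewrite -subr_eq0; apply/eqP.
  have evE s : ev algC (q * q' - 1) s = ev algC q s * ev algC q' s - 1.
    by rewrite /ev !(rmorphB, rmorphM, rmorph1) /= !hornerE.
  rewrite -evE; apply: (ev_transfer l _ _ _ _ _ re rt0).
  by rewrite evE qq' subrr.
have mm : m * m' = 1.
  apply/eqP; rewrite -(eqr_int algC) rmorphM /= -(ratr_int _ m) -(ratr_int _ m').
  rewrite -mE -mE' -!(norm_ratP _ _ _ _ _ h).
  rewrite (mulrACA (ev _ q x * _)) (mulrACA (ev _ q x)) !one ?rt ?eqxx ?orbT //.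
  by rewrite !mulr1.
rewrite mE; have : m = 1 \/ m = -1.
  have : (m %| 1)%Z by apply/dvdzP; exists m'; rewrite mulrC mm.
  by rewrite dvdz1; lia.
by case=> ->; [left | right].
Qed.

End Integrality.

(** * Location of the three real roots *)

Section RealRoots.
Local Open Scope ring_scope.
Variables (R : rcfType) (l : nat).
Hypothesis l_ge : (10 <= l)%N.
Local Notation L := (l%:R : R).
Local Notation u := (L^-1).

Let L10 : 10 <= L. Proof. by rewrite ler_nat. Qed.
Let Lu : L * u = 1. Proof. by rewrite divff //; move: L10; lra. Qed.
Let u0 : 0 < u. Proof. by rewrite invr_gt0; move: L10; lra. Qed.
Let u1 : u <= 1 / 10.
Proof. by rewrite ler_pdivlMr // mulrC -[leRHS]Lu; have := u0; move: L10; nra. Qed.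

Let evalE (x : R) : (map_poly intr (ennola_poly l)).[x] = x * (x - 1) * (x + L) - 1.
Proof. by rewrite map_ennolaE !hornerE. Qed.

(** Each of the three roots is found by a sign change on an interval of length [1 / L]. Writing them
    with a nonnegative offset [y] makes the absolute values of the root [r] and of [r - 1]
    explicit. *)
Lemma ennola_root1 : exists2 y : R, 0 <= y <= u & ennola_root l R (- y).
Proof.
have [||x /andP[x1 x2] rx] := @poly_ivt R (- map_poly intr (ennola_poly l)) (- u) 0.
- by rewrite oppr_le0 ltW.
- rewrite !hornerN !evalE mul0r mul0r sub0r opprK ler01 andbT oppr_le0.
  have -> : - u * (- u - 1) * (- u + L) - 1 = (1 + u) * (L * u - u ^+ 2) - 1 by ring.
  by rewrite Lu; have := u0; have := u1; set v := u; nra.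
exists (- x); first by rewrite oppr_ge0 x2 lerNl x1.
by rewrite opprK /ennola_root -rootN.
Qed.

Lemma ennola_root2 : exists2 y : R, 0 <= y <= u & ennola_root l R (1 + y).
Proof.
have [||x /andP[x1 x2] rx] := @poly_ivt R (map_poly intr (ennola_poly l)) 1 (1 + u).
- by rewrite lerDl ltW.
- rewrite !evalE subrr mulr0 mul0r sub0r lerN10 /=.
  have -> : (1 + u) * (1 + u - 1) * (1 + u + L) - 1 = (1 + u) * (L * u + u + u ^+ 2) - 1 by ring.
  by rewrite Lu; have := u0; set v := u; nra.
exists (x - 1); first by rewrite subr_ge0 x1 lerBlDl.
by rewrite addrC subrK.
Qed.

Lemma ennola_root3 : exists2 y : R, 0 <= y <= u & ennola_root l R (y - L).
Proof.
have [||x /andP[x1 x2] rx] := @poly_ivt R (map_poly intr (ennola_poly l)) (- L) (u - L).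
- by rewrite lerDr ltW.
- rewrite !evalE addNr mulr0 sub0r lerN10 subrK /=.
  have -> : (u - L) * (u - L - 1) * u - 1 = (L * u - u ^+ 2) * (L + 1 - u) - 1 by ring.
  rewrite Lu; have := u0; have := u1; move: L10; set v := u => h1 h2 h3.
  have a : 9 / 10 <= 1 - v ^+ 2 by nra.
  have b : 10 <= L + 1 - v by lra.
  have : 0 <= (1 - v ^+ 2 - 9 / 10) * (L + 1 - v - 10) by rewrite mulr_ge0 // subr_ge0.
  by move: a b; move: (1 - v ^+ 2) (L + 1 - v) => A B; lra.
exists (x + L); first by rewrite -lerBlDr sub0r x1 -lerBrDr.
by rewrite addrK.
Qed.

End RealRoots.

(** * The groups of units *)

Section Units.
Local Open Scope classical_set_scope.
Local Open Scope ring_scope.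
Variables (l : nat) (e : algC).
Hypothesis re : ennola_root l algC e.

Local Notation U := (unit_group e).
Local Notation H := (generated_subgroup [set -1; e; e - 1]).

Let eE : e * (e - 1) * (e + l%:R) = 1.
Proof. by apply/eqP; rewrite -ennola_rootE. Qed.

Lemma gen_neq0 : e != 0.
Proof. by apply: contra_eqN eE => /eqP->; rewrite !mul0r eq_sym oner_eq0. Qed.

Lemma gen_sub1_neq0 : e - 1 != 0.
Proof. by apply: contra_eqN eE => /eqP->; rewrite mulr0 mul0r eq_sym oner_eq0. Qed.

(** The values of rational polynomials at [e] are already closed under subtraction and division. The
    closure lemmas for [conjugates] are reused, with [e] paired with itself. *)
Lemma generated_fieldP x : generated_field e x -> exists q, x = ev algC q e.
Proof.
have conjE y : conjugates algC algC e e y y <-> exists q, y = ev algC q e.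
  by split=> [[q -> _]|[q ->]]; exists q.
rewrite /generated_field => hx.
suff : [set y | exists q, y = ev algC q e] x by [].
move: x hx; apply: smallest_sub => /=; last first.
  by move=> _ ->; exists 'X; rewrite /ev map_polyX hornerX.
split.
- by apply/mem_set => /=; exists 1; rewrite /ev rmorph1 hornerC.
- move=> x y /set_mem/= /conjE hx /set_mem/= /conjE hy.
  by apply/mem_set => /=; apply/conjE; apply: conjB.
move=> x y /set_mem/= /conjE hx /set_mem/= /conjE hy.
by apply/mem_set => /=; apply/conjE; apply: conjM => //; apply: (conjV l).
Qed.

Lemma generated_field_gen : generated_field e e.
Proof. by move=> K [_ h]; apply: h. Qed.

Lemma generated_field1 : generated_field e 1.
Proof. by move=> K [[h _ _] _]; apply: set_mem h. Qed.

Lemma generated_fieldB x y :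
  generated_field e x -> generated_field e y -> generated_field e (x - y).
Proof.
move=> hx hy K hK; have [hx' hy'] := (hx K hK, hy K hK).
by case: hK => [[_ h _] _]; apply/set_mem; apply: h; apply/mem_set.
Qed.

Lemma generated_field_div x y :
  generated_field e x -> generated_field e y -> generated_field e (x / y).
Proof.
move=> hx hy K hK; have [hx' hy'] := (hx K hK, hy K hK).
by case: hK => [[_ _ h] _]; apply/set_mem; apply: h; apply/mem_set.
Qed.

Lemma generated_fieldV x : generated_field e x -> generated_field e x^-1.
Proof. by rewrite -div1r; apply: generated_field_div; apply: generated_field1. Qed.

Lemma generated_fieldM x y :
  generated_field e x -> generated_field e y -> generated_field e (x * y).
Proof.
move=> hx hy; rewrite -[y]invrK; apply: generated_field_div => //.
exact: generated_fieldV.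
Qed.

Lemma unit_groupE x :
  U x <-> [/\ generated_field e x, x != 0, x \in Aint & x^-1 \in Aint].
Proof.
split=> [[[fx ax] [y [[fy ay] xy]]] | [fx x0 ax ax']].
  have x0 : x != 0 by apply: contra_eqN xy => /eqP->; rewrite mul0r eq_sym oner_eq0.
  split=> //; suff -> : x^-1 = y by [].
  by apply: (mulfI x0); rewrite mulfV.
split=> //; exists x^-1; split; last by rewrite mulfV.
by split => //; apply: generated_fieldV.
Qed.

Lemma unit_groupM x y : U x -> U y -> U (x * y).
Proof.
move=> /unit_groupE[fx x0 ax ax'] /unit_groupE[fy y0 ay ay']; apply/unit_groupE.
split; [exact: generated_fieldM | exact: mulf_neq0 | exact: rpredM |].
by rewrite invfM rpredM.
Qed.

Lemma unit_groupV x : U x -> U x^-1.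
Proof.
move=> /unit_groupE[fx x0 ax ax']; apply/unit_groupE.
by split; rewrite ?invr_eq0 ?invrK //; apply: generated_fieldV.
Qed.

Lemma unit_group1 : U 1.
Proof.
apply/unit_groupE; split; rewrite ?invr1 ?rpred1 ?oner_eq0 //.
exact: generated_field1.
Qed.

Let eA : e \in Aint := ennola_root_Aint l e re.

Lemma unit_group_gen : U e.
Proof.
apply/unit_groupE; split => //; [exact: generated_field_gen | exact: gen_neq0 |].
have -> : e^-1 = (e - 1) * (e + l%:R).
  by apply: (mulfI gen_neq0); rewrite mulfV ?gen_neq0 // mulrA.
by rewrite rpredM // ?rpredB ?rpredD ?rpred1 ?rpred_nat.
Qed.

Lemma unit_group_gen_sub1 : U (e - 1).
Proof.
apply/unit_groupE; split => //; [| exact: gen_sub1_neq0 | by rewrite rpredB ?rpred1 |].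
  by apply: generated_fieldB; [exact: generated_field_gen | exact: generated_field1].
have -> : (e - 1)^-1 = e * (e + l%:R).
  apply: (mulfI gen_sub1_neq0); rewrite mulfV ?gen_sub1_neq0 // -[LHS]eE.
  by rewrite mulrA (mulrC e).
by rewrite rpredM // ?rpredD ?rpred_nat.
Qed.

Lemma unit_groupN x : U x -> U (- x).
Proof.
move=> /unit_groupE[fx x0 ax ax']; apply/unit_groupE.
split; rewrite ?oppr_eq0 ?invrN ?rpredN //.
rewrite -[- x]add0r; apply: generated_fieldB => //.
by rewrite -(subrr 1); apply: generated_fieldB; apply: generated_field1.
Qed.

Lemma unit_groupX x (n : nat) : U x -> U (x ^+ n).
Proof.
move=> hx; elim: n => [|n IH]; first exact: unit_group1.
by rewrite exprS; apply: unit_groupM.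
Qed.

Lemma unit_groupXz x (n : int) : U x -> U (x ^ n).
Proof.
move=> hx; case: n => n; first exact: unit_groupX.
by rewrite NegzE -exprnN; apply: unit_groupV; apply: unit_groupX.
Qed.

(** Products of this form are closed under division, which bounds the smallest closed set from
    above; conversely, powers of the generators lie in every closed set. *)
Lemma subgroupP x : H x <-> exists (s : bool) (I J : int), x = (-1) ^+ s * e ^ I * (e - 1) ^ J.
Proof.
have e0 := gen_neq0; have e1 := gen_sub1_neq0; split=> [hx | [s [I [J ->]]]].
  suff : [set y | exists (s : bool) (I J : int), y = (-1) ^+ s * e ^ I * (e - 1) ^ J] x by [].
  move: x hx; apply: smallest_sub => /=; last first.
    move=> y [[->|->]|->] /=.
    - by exists true, 0, 0; rewrite !expr0z !mulr1 expr1.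
    - by exists false, 1, 0; rewrite expr0z expr1z mulr1 mul1r.
    - by exists false, 0, 1; rewrite expr0z expr1z mulr1 mul1r.
  split; first by apply/mem_set; exists false, 0, 0; rewrite !expr0z !mulr1.
  move=> y z /set_mem/= [s [I [J ->]]] /set_mem/= [t [I' [J' ->]]].
  apply/mem_set => /=; exists (s (+) t), (I - I'), (J - J').
  by rewrite !expfzDr // !invfM -!invr_expz signr_addb invr_sign; ring.
have [M1 MD] : [set K : set algC | divr_closed (mem K)] H.
  split; first by apply/mem_set => K [[h _] _]; apply: set_mem h.
  move=> y z /set_mem hy /set_mem hz; apply/mem_set => K hK.
  have [hy' hz'] := (hy K hK, hz K hK).
  by case: hK => [[_ h] _]; apply/set_mem; apply: h; apply/mem_set.
have HV y : H y -> H y^-1.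
  by move=> hy; apply/set_mem; rewrite -div1r; apply: MD => //; apply/mem_set.
have HM y z : H y -> H z -> H (y * z).
  by move=> hy hz; apply/set_mem; rewrite -[z]invrK; apply: MD; apply/mem_set => //; apply: HV.
have HX y (n : int) : H y -> H (y ^ n).
  have HXn (k : nat) : H y -> H (y ^+ k).
    move=> hy; elim: k => [|k IH]; first by apply: set_mem M1.
    by rewrite exprS; apply: HM.
  move=> hy; case: n => n; first exact: HXn.
  by rewrite NegzE -exprnN; apply: HV; exact: HXn.
apply: (HM); first apply: (HM).
- by rewrite exprnP; apply: (HX) => K [_ h]; apply: h; left; left.
- by apply: (HX) => K [_ h]; apply: h; left; right.
- by apply: (HX) => K [_ h]; apply: h; right.
Qed.

Lemma subgroup_unit x : H x -> U x.
Proof.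
move=> /subgroupP[s [I [J ->]]]; apply: unit_groupM; first apply: unit_groupM.
- by case: s; [apply: unit_groupN; exact: unit_group1 | exact: unit_group1].
- exact: unit_groupXz unit_group_gen.
- exact: unit_groupXz unit_group_gen_sub1.
Qed.

Lemma subgroupM x y : H x -> H y -> H (x * y).
Proof.
move=> /subgroupP[s [I [J ->]]] /subgroupP[t [I' [J' ->]]]; apply/subgroupP.
exists (s (+) t), (I + I'), (J + J').
by rewrite !expfzDr ?gen_neq0 ?gen_sub1_neq0 // signr_addb; ring.
Qed.

Lemma subgroupV x : H x -> H x^-1.
Proof.
move=> /subgroupP[s [I [J ->]]]; apply/subgroupP; exists s, (- I), (- J).
by rewrite !invfM !invr_expz invr_sign.
Qed.

Lemma subgroup1 : H 1.
Proof. by apply/subgroupP; exists false, 0, 0; rewrite !expr0z !mulr1. Qed.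

End Units.

(** * Finiteness of the index *)

Section Descent.
Local Open Scope ring_scope.

(** Here [a >= b >= c] stand for the squared conjugates of a unit and [A], [B], [C] for those of a
    multiplier. The gain [3a/4] exceeds the losses: at most [a/2] from [b], and at most
    [4 L^2 < a/4] from [c], as [c <= 1]. *)
Lemma weighted_decrease (R : realFieldType) (L a b c A B C : R) :
  0 <= b -> 0 <= c -> 16 * L ^+ 2 < a -> b <= a -> c <= b ->
  1 <= a -> a * b * c = 1 ->
  A <= 1 / 4 -> B <= 3 / 2 -> C <= 4 * L ^+ 2 ->
  a * A + b * B + c * C < a + b + c.
Proof.
move=> b0 c0 aL ba cb a1 abc hA hB hC.
have c1 : c <= 1.
  rewrite leNgt; apply/negP => c1.
  have ab : 1 <= a * b by rewrite (le_trans a1) // ler_peMr; lra.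
  by have := ler_wpM2r c0 ab; rewrite abc; lra.
have h1 := ler_wpM2l (le_trans ler01 a1) hA.
have h2 := ler_wpM2l b0 hB.
have h3 : c * C <= 4 * L ^+ 2.
  apply: (le_trans (ler_wpM2l c0 hC)); rewrite ler_piMl // mulr_ge0 //.
  by rewrite exprn_even_ge0.
lra.
Qed.

(** In the proof [Kij] is the case where value [i] is the largest and value [j] the smallest. *)
Lemma max_min_cases (R : realFieldType) (T a1 a2 a3 : R) (P : Prop) :
  (T < a1 -> a2 <= a1 -> a3 <= a2 -> P) -> (T < a1 -> a3 <= a1 -> a2 <= a3 -> P) ->
  (T < a2 -> a1 <= a2 -> a3 <= a1 -> P) -> (T < a2 -> a3 <= a2 -> a1 <= a3 -> P) ->
  (T < a3 -> a1 <= a3 -> a2 <= a1 -> P) -> (T < a3 -> a2 <= a3 -> a1 <= a2 -> P) ->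
  T < a1 \/ T < a2 \/ T < a3 -> P.
Proof.
move=> K13 K12 K23 K21 K32 K31 big.
have [h12|/ltW h12] := lerP a1 a2; have [h23|/ltW h23] := lerP a2 a3;
  have [h13|/ltW h13] := lerP a1 a3.
- by apply: K31 => //; case: big => [|[|]]; lra.
- by apply: K31 => //; case: big => [|[|]]; lra.
- by apply: K21 => //; case: big => [|[|]]; lra.
- by apply: K23 => //; case: big => [|[|]]; lra.
- by apply: K32 => //; case: big => [|[|]]; lra.
- by apply: K12 => //; case: big => [|[|]]; lra.
- by apply: K13 => //; case: big => [|[|]]; lra.
- by apply: K13 => //; case: big => [|[|]]; lra.
Qed.

Definition place_value (R : unitRingType) (r : R) (I J : int) : R := r ^ I * (r - 1) ^ J.

Section RealPlaces.
Variables (R : realFieldType) (L : R).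
Hypothesis L_ge : 100 <= L.
Local Notation pv := (place_value R).

Let sq_le (x b : R) : 0 <= x <= b -> x ^+ 2 <= b ^+ 2.
Proof. by case/andP=> x0 xb; rewrite lerXn2r // nnegrE // (le_trans x0). Qed.

Let b12 (x : R) : 0 <= x <= 1 / 2 -> x ^+ 2 <= 4^-1.
Proof. by move/sq_le; lra. Qed.
Let b32 (x : R) : 0 <= x <= 11 / 10 -> x ^+ 2 <= 3 / 2.
Proof. by move/sq_le; lra. Qed.
Let b2L (x : R) : 0 <= x <= 2 * L -> x ^+ 2 <= 4 * L ^+ 2.
Proof. by move/sq_le; rewrite exprMn; lra. Qed.

Let dv (x y t : R) : 0 <= x -> 0 < y -> x <= t * y -> 0 <= x / y <= t.
Proof. by move=> x0 y0 h; rewrite ler_pdivrMr // h divr_ge0 // ltW. Qed.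
Let iv (y t : R) : 0 < y -> 1 <= t * y -> 0 <= y^-1 <= t.
Proof. by move=> y0 h; rewrite -div1r; apply: dv. Qed.

Let place_valueE (r s t : R) I J : r ^+ 2 = s ^+ 2 -> (r - 1) ^+ 2 = t ^+ 2 ->
  pv r I J ^+ 2 = (s ^ I * t ^ J) ^+ 2.
Proof.
by move=> hs ht; rewrite /place_value !exprMn !exprnP !(exprzAC _ _ 2) -!exprnP hs ht.
Qed.

(** The six multipliers split into three pairs, small, near 1, or of size about [L]. The next two
    lemmas sort them in the same way at the other roots. *)
Lemma place1_bounds (y1 : R) : 0 <= y1 <= 1 / 100 -> y1 * (1 + y1) * (L - y1) = 1 ->
  pv (- y1) 1 0 ^+ 2 <= 1 / 4 /\
  pv (- y1) 1 (-1) ^+ 2 <= 1 / 4 /\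
  pv (- y1) 0 1 ^+ 2 <= 3 / 2 /\
  pv (- y1) 0 (-1) ^+ 2 <= 3 / 2 /\
  pv (- y1) (-1) 0 ^+ 2 <= 4 * L ^+ 2 /\
  pv (- y1) (-1) 1 ^+ 2 <= 4 * L ^+ 2.
Proof.
have L1 := L_ge; move=> /andP[y0 ys] e.
have yn : y1 != 0 by apply: contra_eqN e => /eqP->; rewrite !(mul0r, mulr0) eq_sym oner_eq0.
have iy : y1^-1 = (1 + y1) * (L - y1).
  by apply: (mulfI yn); rewrite mulfV // mulrA e.
have q : 0 <= (1 + y1) * (L - y1) <= 11 / 10 * L.
  apply/andP; split; first by apply: mulr_ge0; lra.
  apply: (le_trans (ler_pM _ _ (_ : 1 + y1 <= 101 / 100) (_ : L - y1 <= L))); lra.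
have q' : 0 <= (1 + y1) * ((1 + y1) * (L - y1)) <= 2 * L.
  case/andP: q => q0 q; apply/andP; split; first by apply: mulr_ge0 => //; lra.
  apply: (le_trans (ler_pM _ _ (_ : 1 + y1 <= 101 / 100) q)) => //; lra.
have {}q : 0 <= (1 + y1) * (L - y1) <= 2 * L by lra.
have E I J : pv (- y1) I J ^+ 2 = (y1 ^ I * (1 + y1) ^ J) ^+ 2.
  by apply: place_valueE; ring.
rewrite !E !expr0z !expr1z !exprN1 !mulr1 !mul1r.
do !split.
- by apply: b12; lra.
- by apply: b12; apply: dv; lra.
- by apply: b32; lra.
- by apply: b32; apply: iv; lra.
- by apply: b2L; rewrite iy q; lra.
- by apply: b2L; rewrite mulrC iy q'.
Qed.

Lemma place2_bounds (y2 : R) : 0 <= y2 <= 1 / 100 -> (1 + y2) * y2 * (L + 1 + y2) = 1 ->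
  pv (1 + y2) 0 1 ^+ 2 <= 1 / 4 /\
  pv (1 + y2) (-1) 1 ^+ 2 <= 1 / 4 /\
  pv (1 + y2) 1 0 ^+ 2 <= 3 / 2 /\
  pv (1 + y2) (-1) 0 ^+ 2 <= 3 / 2 /\
  pv (1 + y2) 0 (-1) ^+ 2 <= 4 * L ^+ 2 /\
  pv (1 + y2) 1 (-1) ^+ 2 <= 4 * L ^+ 2.
Proof.
have L1 := L_ge; move=> /andP[y0 ys] e.
have yn : y2 != 0 by apply: contra_eqN e => /eqP->; rewrite !(mul0r, mulr0) eq_sym oner_eq0.
have iy : y2^-1 = (1 + y2) * (L + 1 + y2).
  by apply: (mulfI yn); rewrite mulfV // mulrA (mulrC y2) e.
have q : 0 <= (1 + y2) * (L + 1 + y2) <= 11 / 10 * L.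
  apply/andP; split; first by apply: mulr_ge0; lra.
  apply: (le_trans (ler_pM _ _ (_ : 1 + y2 <= 101 / 100) (_ : L + 1 + y2 <= 103 / 100 * L))); lra.
have q' : 0 <= (1 + y2) * ((1 + y2) * (L + 1 + y2)) <= 2 * L.
  case/andP: q => q0 q; apply/andP; split; first by apply: mulr_ge0 => //; lra.
  apply: (le_trans (ler_pM _ _ (_ : 1 + y2 <= 101 / 100) q)) => //; lra.
have {}q : 0 <= (1 + y2) * (L + 1 + y2) <= 2 * L by lra.
have E I J : pv (1 + y2) I J ^+ 2 = ((1 + y2) ^ I * y2 ^ J) ^+ 2.
  by apply: place_valueE; ring.
rewrite !E !expr0z !expr1z !exprN1 !mulr1 !mul1r.
do !split.
- by apply: b12; lra.
- by apply: b12; rewrite mulrC; apply: dv; lra.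
- by apply: b32; lra.
- by apply: b32; apply: iv; lra.
- by apply: b2L; rewrite iy q; lra.
- by apply: b2L; rewrite iy q'.
Qed.

Lemma place3_bounds (y3 : R) : 0 <= y3 <= 1 / 100 ->
  pv (y3 - L) (-1) 0 ^+ 2 <= 1 / 4 /\
  pv (y3 - L) 0 (-1) ^+ 2 <= 1 / 4 /\
  pv (y3 - L) 1 (-1) ^+ 2 <= 3 / 2 /\
  pv (y3 - L) (-1) 1 ^+ 2 <= 3 / 2 /\
  pv (y3 - L) 1 0 ^+ 2 <= 4 * L ^+ 2 /\
  pv (y3 - L) 0 1 ^+ 2 <= 4 * L ^+ 2.
Proof.
have L1 := L_ge; move=> /andP[y0 ys].
have E I J : pv (y3 - L) I J ^+ 2 = ((L - y3) ^ I * (L + 1 - y3) ^ J) ^+ 2.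
  by apply: place_valueE; ring.
rewrite !E !expr0z !expr1z !exprN1 !mulr1 !mul1r.
do !split.
- by apply: b12; apply: iv; lra.
- by apply: b12; apply: iv; lra.
- by apply: b32; apply: dv; lra.
- by apply: b32; rewrite mulrC; apply: dv; lra.
- by apply: b2L; lra.
- by apply: b2L; lra.
Qed.

(** For each ordered pair of roots exactly one of the six multipliers is small at the first and of
    size about [L] at the second. It is used when the first root carries the largest conjugate and
    the second the smallest. *)
Lemma exists_decreasing_unit (y1 y2 y3 a1 a2 a3 : R) :
  0 <= y1 <= L^-1 -> 0 <= y2 <= L^-1 -> 0 <= y3 <= L^-1 ->
  y1 * (1 + y1) * (L - y1) = 1 -> (1 + y2) * y2 * (L + 1 + y2) = 1 ->
  0 <= a1 -> 0 <= a2 -> 0 <= a3 -> a1 * a2 * a3 = 1 ->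
  16 * L ^+ 2 < a1 \/ 16 * L ^+ 2 < a2 \/ 16 * L ^+ 2 < a3 ->
  exists I J : int, a1 * pv (- y1) I J ^+ 2 + a2 * pv (1 + y2) I J ^+ 2
    + a3 * pv (y3 - L) I J ^+ 2 < a1 + a2 + a3.
Proof.
move=> hy1 hy2 hy3 e1 e2 a10 a20 a30 prod.
have small (y : R) : 0 <= y <= L^-1 -> 0 <= y <= 1 / 100.
  have L1 := L_ge; have L0 : 0 < L by lra.
  move=> /andP[-> h] /=; apply: (le_trans h); rewrite -div1r ler_pdivrMr //.
  by lra.
have [p10 [p11 [p12 [p13 [p14 [p15]]]]]] := place1_bounds y1 (small _ hy1) e1.
have [p20 [p21 [p22 [p23 [p24 [p25]]]]]] := place2_bounds y2 (small _ hy2) e2.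
have [p30 [p31 [p32 [p33 [p34 [p35]]]]]] := place3_bounds y3 (small _ hy3).
have LL : 1 <= 16 * L ^+ 2 by rewrite expr2; have := ler_pM (ler0n _ 100) (ler0n _ 100) L_ge L_ge; lra.
move: small LL => _ LL; apply: max_min_cases => h1 h2 h3.
- exists 1, 0.
  by apply: (weighted_decrease R L) => //; exact: le_trans LL (ltW h1).
- exists 1, (-1).
  have -> : a1 * pv (- y1) 1 (-1) ^+ 2 + a2 * pv (1 + y2) 1 (-1) ^+ 2 + a3 * pv (y3 - L) 1 (-1) ^+ 2 =
     a1 * pv (- y1) 1 (-1) ^+ 2 + a3 * pv (y3 - L) 1 (-1) ^+ 2 + a2 * pv (1 + y2) 1 (-1) ^+ 2 by ring.
  have -> : a1 + a2 + a3 = a1 + a3 + a2 by ring.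
  apply: (weighted_decrease R L) => //; first exact: le_trans LL (ltW h1).
  by rewrite -prod; ring.
- exists 0, 1.
  have -> : a1 * pv (- y1) 0 1 ^+ 2 + a2 * pv (1 + y2) 0 1 ^+ 2 + a3 * pv (y3 - L) 0 1 ^+ 2 =
     a2 * pv (1 + y2) 0 1 ^+ 2 + a1 * pv (- y1) 0 1 ^+ 2 + a3 * pv (y3 - L) 0 1 ^+ 2 by ring.
  have -> : a1 + a2 + a3 = a2 + a1 + a3 by ring.
  apply: (weighted_decrease R L) => //; first exact: le_trans LL (ltW h1).
  by rewrite -prod; ring.
- exists (-1), 1.
  have -> : a1 * pv (- y1) (-1) 1 ^+ 2 + a2 * pv (1 + y2) (-1) 1 ^+ 2 + a3 * pv (y3 - L) (-1) 1 ^+ 2 =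
     a2 * pv (1 + y2) (-1) 1 ^+ 2 + a3 * pv (y3 - L) (-1) 1 ^+ 2 + a1 * pv (- y1) (-1) 1 ^+ 2 by ring.
  have -> : a1 + a2 + a3 = a2 + a3 + a1 by ring.
  apply: (weighted_decrease R L) => //; first exact: le_trans LL (ltW h1).
  by rewrite -prod; ring.
- exists 0, (-1).
  have -> : a1 * pv (- y1) 0 (-1) ^+ 2 + a2 * pv (1 + y2) 0 (-1) ^+ 2 + a3 * pv (y3 - L) 0 (-1) ^+ 2 =
     a3 * pv (y3 - L) 0 (-1) ^+ 2 + a1 * pv (- y1) 0 (-1) ^+ 2 + a2 * pv (1 + y2) 0 (-1) ^+ 2 by ring.
  have -> : a1 + a2 + a3 = a3 + a1 + a2 by ring.
  apply: (weighted_decrease R L) => //; first exact: le_trans LL (ltW h1).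
  by rewrite -prod; ring.
- exists (-1), 0.
  have -> : a1 * pv (- y1) (-1) 0 ^+ 2 + a2 * pv (1 + y2) (-1) 0 ^+ 2 + a3 * pv (y3 - L) (-1) 0 ^+ 2 =
     a3 * pv (y3 - L) (-1) 0 ^+ 2 + a2 * pv (1 + y2) (-1) 0 ^+ 2 + a1 * pv (- y1) (-1) 0 ^+ 2 by ring.
  have -> : a1 + a2 + a3 = a3 + a2 + a1 by ring.
  apply: (weighted_decrease R L) => //; first exact: le_trans LL (ltW h1).
  by rewrite -prod; ring.
Qed.

End RealPlaces.
End Descent.

(** * Coset representatives with bounded conjugates *)

Section FiniteIndex.
Local Open Scope classical_set_scope.
Local Open Scope ring_scope.
Variables (l : nat) (e : algC).
Hypotheses (l_ge : (100 <= l)%N) (re : ennola_root l algC e).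
Local Notation U := (unit_group e).
Local Notation H := (generated_subgroup [set -1; e; e - 1]).

Lemma ennola_real_split (R : rcfType) : exists y1 y2 y3 : R,
  [/\ 0 <= y1 <= l%:R^-1, 0 <= y2 <= l%:R^-1, 0 <= y3 <= l%:R^-1,
      ennola_split l R (- y1) (1 + y2) (y3 - l%:R) &
      y1 * (1 + y1) * (l%:R - y1) = 1 /\ (1 + y2) * y2 * (l%:R + 1 + y2) = 1].
Proof.
have l10 : (10 <= l)%N by apply: leq_trans l_ge.
have [y1 h1 r1] := ennola_root1 R l l10; have [y2 h2 r2] := ennola_root2 R l l10.
have [y3 h3 r3] := ennola_root3 R l l10; exists y1, y2, y3.
have L100 : 100 <= l%:R :> R by rewrite ler_nat.
have u1 : l%:R^-1 <= 1 / 100 :> R.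
  by rewrite -div1r ler_pdivrMr; lra.
split => //; last first.
  move: r1 r2; rewrite !ennola_rootE => /eqP r1 /eqP r2.
  by split; [rewrite -[RHS]r1 | rewrite -[RHS]r2]; ring.
case/andP: h1 => h1 h1'; case/andP: h2 => h2 h2'; case/andP: h3 => h3 h3'.
by apply: ennola_split_roots => //; lra.
Qed.

Lemma conj_unit (R : rcfType) (x : algC) (r y : R) (I J : int) :
  ennola_root l R r -> conjugates algC R e r x y ->
  conjugates algC R e r (x * (e ^ I * (e - 1) ^ J)) (y * place_value R r I J).
Proof.
move=> rr h; apply: conjM => //; apply: conjM; apply: (conjXz l) => //.
  exact: conj_gen.
by apply: conjB; [exact: conj_gen | exact: conj1].
Qed.

(* Descent on the positive integer [Tr ((x * h) ^+ 2)]. *)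
Lemma bounded_representative (R : rcfType) (y1 y2 y3 : R) x :
  0 <= y1 <= l%:R^-1 -> 0 <= y2 <= l%:R^-1 -> 0 <= y3 <= l%:R^-1 ->
  ennola_split l R (- y1) (1 + y2) (y3 - l%:R) ->
  y1 * (1 + y1) * (l%:R - y1) = 1 -> (1 + y2) * y2 * (l%:R + 1 + y2) = 1 ->
  U x -> exists h q, [/\ H h, x * h = ev algC q e,
    ev R q (- y1) ^+ 2 <= 16 * l%:R ^+ 2, ev R q (1 + y2) ^+ 2 <= 16 * l%:R ^+ 2 &
    ev R q (y3 - l%:R) ^+ 2 <= 16 * l%:R ^+ 2].
Proof.
move=> h1 h2 h3 split_R e1 e2 Ux.
have evX (F : numFieldType) q t : ev F (q ^+ 2) t = ev F q t ^+ 2.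
  by rewrite /ev rmorphXn hornerE.
have rt t : [|| t == - y1, t == 1 + y2 | t == y3 - l%:R] -> ennola_root l R t.
  by rewrite -(ennola_split_root _ _ _ _ _ _ split_R).
have [/rt r1 /rt r2 /rt r3] : [/\ [|| - y1 == - y1, - y1 == 1 + y2 | - y1 == y3 - l%:R],
   [|| 1 + y2 == - y1, 1 + y2 == 1 + y2 | 1 + y2 == y3 - l%:R] &
   [|| y3 - l%:R == - y1, y3 - l%:R == 1 + y2 | y3 - l%:R == y3 - l%:R]].
  by rewrite !eqxx !orbT.
(* Induction on a natural bound [n] for the sum of the squared conjugates; the first bound is the
   absolute value of an integer trace. *)
suff main (n : nat) y q : U y -> y = ev algC q e ->
    ev R q (- y1) ^+ 2 + ev R q (1 + y2) ^+ 2 + ev R q (y3 - l%:R) ^+ 2 <= n%:R ->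
    exists h q, [/\ H h, y * h = ev algC q e,
    ev R q (- y1) ^+ 2 <= 16 * l%:R ^+ 2, ev R q (1 + y2) ^+ 2 <= 16 * l%:R ^+ 2 &
    ev R q (y3 - l%:R) ^+ 2 <= 16 * l%:R ^+ 2].
  have [q xE] : exists q, x = ev algC q e.
    by apply: (generated_fieldP l e re); case/unit_groupE: Ux.
  have [z zE] : exists z : int, trace_rat l (q ^+ 2) = z%:~R.
    by apply: (trace_int l e) => //; rewrite evX -xE rpredX //; case/(unit_groupE e): Ux.
  apply: (main `|z|%N x q Ux xE).
  rewrite -!evX (trace_ratP _ _ _ _ _ _ split_R) zE ratr_int.
  by rewrite -[n in _ <= n]/(`|z|%N%:Z%:~R) ler_int abszE ler_norm.
move: n y q; have L100 : 100 <= l%:R :> R by rewrite ler_nat.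
have next m y q : U y -> y = ev algC q e ->
    ev R q (- y1) ^+ 2 + ev R q (1 + y2) ^+ 2 + ev R q (y3 - l%:R) ^+ 2 <= m%:R ->
    16 * l%:R ^+ 2 < ev R q (- y1) ^+ 2 \/ 16 * l%:R ^+ 2 < ev R q (1 + y2) ^+ 2 \/
    16 * l%:R ^+ 2 < ev R q (y3 - l%:R) ^+ 2 ->
    (0 < m)%N /\ exists h q', [/\ H h, y * h = ev algC q' e &
    ev R q' (- y1) ^+ 2 + ev R q' (1 + y2) ^+ 2 + ev R q' (y3 - l%:R) ^+ 2 <= m.-1%:R].
  move=> Uy yE hm big.
  (* The product of the squared conjugates is the square of the norm of a unit. *)
  have prod : ev R q (- y1) ^+ 2 * ev R q (1 + y2) ^+ 2 * ev R q (y3 - l%:R) ^+ 2 = 1.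
    rewrite -!exprMn (norm_ratP _ _ _ _ _ _ split_R).
    have [q' yE'] : exists q', y^-1 = ev algC q' e.
      by apply: (generated_fieldP l e re); case/(unit_groupE e): (unit_groupV e _ Uy).
    have [fy y0 ay ay'] := proj1 (unit_groupE e y) Uy.
    have [|||->|->] := norm_unit l e q q' re; rewrite -?yE -?yE' //.
    - by rewrite mulfV.
    - by rewrite rmorph1 expr1n.
    - by rewrite rmorphN1 sqrrN expr1n.
  have [I [J dec]] := exists_decreasing_unit R l%:R L100 y1 y2 y3 _ _ _ h1 h2 h3 e1 e2
     (sqr_ge0 _) (sqr_ge0 _) (sqr_ge0 _) prod big.
  set h := e ^ I * (e - 1) ^ J.
  have Hh : H h.
    by apply/(subgroupP l e re); exists false, I, J; rewrite mul1r.
  have Uyh : U (y * h) by apply: unit_groupM => //; apply: (subgroup_unit l e re).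
  have [q' yE'] : exists q', y * h = ev algC q' e.
    by apply: (generated_fieldP l e re); case/(unit_groupE e): Uyh.
  have evE r : ennola_root l R r -> ev R q' r = ev R q r * place_value R r I J.
    move=> rr; apply: (conj_fun l algC R e r re rr (y * h)); first by exists q'.
    by apply: conj_unit => //; exists q.
  move: dec; rewrite -!exprMn -!evE // => dec.
  have [z zE] : exists z : int, trace_rat l (q' ^+ 2) = z%:~R.
    by apply: (trace_int l e) => //; rewrite evX -yE' rpredX //; case/(unit_groupE e): Uyh.
  have sumE : ev R q' (- y1) ^+ 2 + ev R q' (1 + y2) ^+ 2 + ev R q' (y3 - l%:R) ^+ 2 = z%:~R.
    by rewrite -!evX (trace_ratP _ _ _ _ _ _ split_R) zE ratr_int.
  have z0 : 0 <= z.
    by rewrite -(ler_int R) -sumE !addr_ge0 // sqr_ge0.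
  (* Strict decrease between integers lets the bound drop by one. *)
  have zm : z < m%:Z.
    by rewrite -(ltr_int R) -sumE; apply: lt_le_trans dec hm.
  split; first by clear -z0 zm; lia.
  exists h, q'; split=> //; rewrite sumE -[m.-1%:R]/(m.-1%:Z%:~R) ler_int.
  by clear -z0 zm; lia.
have bounded_or_big y q : y = ev algC q e ->
    (exists h q, [/\ H h, y * h = ev algC q e,
      ev R q (- y1) ^+ 2 <= 16 * l%:R ^+ 2, ev R q (1 + y2) ^+ 2 <= 16 * l%:R ^+ 2 &
      ev R q (y3 - l%:R) ^+ 2 <= 16 * l%:R ^+ 2]) \/
    (16 * l%:R ^+ 2 < ev R q (- y1) ^+ 2 \/ 16 * l%:R ^+ 2 < ev R q (1 + y2) ^+ 2 \/
      16 * l%:R ^+ 2 < ev R q (y3 - l%:R) ^+ 2).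
  have [b1|b1] := lerP (ev R q (- y1) ^+ 2) (16 * l%:R ^+ 2); last by right; left.
  have [b2|b2] := lerP (ev R q (1 + y2) ^+ 2) (16 * l%:R ^+ 2); last by right; right; left.
  have [b3|b3] := lerP (ev R q (y3 - l%:R) ^+ 2) (16 * l%:R ^+ 2); last by right; right; right.
  by left; exists 1, q; split=> //; [exact: (subgroup1 l e re) | rewrite mulr1].
elim=> [|n IH] y q Uy yE hn; have [//|big] := bounded_or_big y q yE.
  by have [] := next _ y q Uy yE hn big.
have [_ [h [q' [Hh yE' hn']]]] := next _ y q Uy yE hn big.
have Uyh : U (y * h) by apply: unit_groupM => //; apply: (subgroup_unit l e re).
have [h' [q'' [Hh' E B1 B2 B3]]] := IH _ _ Uyh yE' hn'.
exists (h * h'), q''; split=> //; last by rewrite mulrA.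
exact: (subgroupM l e re).
Qed.

Lemma finite_roots (P : {poly algC}) : P != 0 -> finite_set [set x | root P x].
Proof.
move=> P0; have [rs Ers] := closed_field_poly_normal P.
apply: (@sub_finite_set _ _ [set` rs]); last exact: finite_seq.
move=> x /=; rewrite Ers rootZ ?lead_coef_eq0 //.
by rewrite root_prod_XsubC.
Qed.

Lemma finite_int_interval (m : int) : finite_set [set z : int | `|z| <= m].
Proof.
apply: (@sub_finite_set _ _ ([set k%:Z | k in `I_(`|m|.+1)] `|`
    [set - k%:Z | k in `I_(`|m|.+1)])); last first.
  by rewrite finite_setU; split; apply: finite_image; apply: finite_II.
move=> z /= hz; have [z0|z0] := leP 0 z; [left | right]; exists `|z|%N => /=; lia.
Qed.

(** A representative with bounded conjugates has a bounded integer trace, trace of the square and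
    norm, so it is a root of one of finitely many cubics. *)
Lemma finite_cosets : finite_set (cosets U H).
Proof.
have [y1 [y2 [y3 [h1 h2 h3 split_R [e1 e2]]]]] := ennola_real_split algR.
(* The squared conjugates sum to at most [48 l^2], and the square of the trace is at most three
   times that sum, so [200 l^2] bounds both. *)
pose B : int := 200 * l%:Z ^+ 2.
(* Twice the characteristic polynomial of an element with trace [t.1.1], trace of the square [t.1.2]
   and norm [t.2]; the factor 2 clears the denominator of the second symmetric function. *)
pose P (t : int * int * int) : {poly algC} :=
  2 *: 'X^3 - (2 * t.1.1)%:~R *: 'X^2 + (t.1.1 ^+ 2 - t.1.2)%:~R *: 'X - (2 * t.2)%:~R%:P.
pose I := [set z : int | `|z| <= B].
pose S := \bigcup_(t in (I `*` I) `*` I) [set x | root (P t) x].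
have finS : finite_set S.
  apply: bigcup_finite => [|t _].
    by apply: finite_setX; [apply: finite_setX|]; exact: finite_int_interval.
  apply: finite_roots; apply/eqP => /(congr1 (fun p : {poly algC} => p`_3)).
  rewrite /P !coefE /= !(mulr0, mulr1, addr0, subr0).
  by move/eqP; rewrite pnatr_eq0.
apply: (@sub_finite_set _ _ [set [set x * h | h in H] | x in S]); last exact: finite_image.
move=> _ [x Ux <-] /=.
have [h [q [Hh xE b1 b2 b3]]] :=
  bounded_representative _ _ _ _ x h1 h2 h3 split_R e1 e2 Ux.
exists (x * h); last first.
  apply/seteqP; split=> _ [k Hk <-].
    by exists (h * k); rewrite ?mulrA //; apply: (subgroupM l e re).
  exists (h^-1 * k); first by apply: (subgroupM l e re) => //; apply: (subgroupV l e re).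
  rewrite mulrA mulfK //; have [] // := proj1 (unit_groupE e h) (subgroup_unit l e re h Hh).
have Uy : U (x * h) by apply: unit_groupM => //; apply: (subgroup_unit l e re).
move: (x * h) Uy xE => y Uy yE {x h Ux Hh}.
have [fy y0 ay ay'] := proj1 (unit_groupE e y) Uy.
have evX (F : numFieldType) p t : ev F (p ^+ 2) t = ev F p t ^+ 2.
  by rewrite /ev rmorphXn hornerE.
have [s1 s1E] : exists z : int, trace_rat l q = z%:~R.
  by apply: (trace_int l e) => //; rewrite -yE.
have [t2 t2E] : exists z : int, trace_rat l (q ^+ 2) = z%:~R.
  by apply: (trace_int l e) => //; rewrite evX -yE rpredX.
have [s3 s3E s31] : exists2 z : int, norm_rat l q = z%:~R & `|z| = 1.
  have [q' yE'] : exists q', y^-1 = ev algC q' e.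
    by apply: (generated_fieldP l e re); case/(unit_groupE e): (unit_groupV e _ Uy).
  have [|||->|->] := norm_unit l e q q' re; rewrite -?yE -?yE' //.
  - by rewrite mulfV.
  - by exists 1.
  - by exists (-1).
exists (s1, t2, s3) => /=.
  have T1 := trace_ratP _ _ _ _ _ q split_R; rewrite s1E ratr_int in T1.
  have T2 := trace_ratP _ _ _ _ _ (q ^+ 2) split_R; rewrite t2E ratr_int !evX in T2.
  move: b1 b2 b3 T1 T2.
  move: (ev algR q (- y1)) (ev algR q (1 + y2)) (ev algR q (y3 - l%:R)) => a b c.
  move=> b1 b2 b3 T1 T2.
  have L1 : 1 <= l%:Z ^+ 2 by rewrite exprn_ege1 //; clear -l_ge; lia.
  have t2le : t2 <= B.
    by rewrite -(ler_int algR) -T2 /B rmorphM rmorph_nat rmorphXn /= -pmulrn; have := sqr_ge0 (l%:R : algR); lra.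
  have t2ge : 0 <= t2 by rewrite -(ler_int algR) -T2 !addr_ge0 // sqr_ge0.
  have s12 : s1 ^+ 2 <= B.
    rewrite -(ler_int algR) rmorphXn /= -T1 /B rmorphM rmorph_nat rmorphXn /= -pmulrn.
    have := sqr_ge0 (a - b); have := sqr_ge0 (b - c); have := sqr_ge0 (c - a).
    have := sqr_ge0 (l%:R : algR); lra.
  split; first split => /=.
  - rewrite /I /=; apply: le_trans s12; rewrite -(@real_normK _ s1) ?num_real //.
    by move: `|s1| (normr_ge0 s1) => k; clear; nia.
  - by rewrite /I /= ger0_norm.
  - by rewrite /I /= s31 /B; clear -L1; lia.
have [x1 [x2 [x3 split_C]]] := ennola_split_algC l.
have T1 := trace_ratP _ _ _ _ _ q split_C; rewrite s1E ratr_int in T1.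
have T2 := trace_ratP _ _ _ _ _ (q ^+ 2) split_C; rewrite t2E ratr_int !evX in T2.
have T3 := norm_ratP _ _ _ _ _ q split_C; rewrite s3E ratr_int in T3.
rewrite /P rootE !hornerE /= !(rmorphM, rmorphB, rmorphXn) /= -T1 -T2 -T3 yE.
have := re; rewrite (ennola_split_root _ _ _ _ _ _ split_C).
by case/or3P => /eqP ->; apply/eqP; ring.
Qed.

End FiniteIndex.

(** * Cauchy's theorem for cosets *)

Section AbstractCauchy.
Variables (T : finType) (mul : T -> T -> T) (one : T) (inv : T -> T).
Hypotheses (mulA : associative mul) (mul1 : left_id one mul)
  (mulV : left_inverse one inv mul).

(** An alias of [T] that can carry the group structure built from the given operations. *)
Definition cauchy_carrier : Type := T.
HB.instance Definition _ := Finite.on cauchy_carrier.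
HB.instance Definition _ := Finite_isGroup.Build cauchy_carrier mulA mul1 mulV.

(** The power is written with [iter], which keeps the group instance on the alias out of the
    statement. *)
Lemma Cauchy_finType (p : nat) : prime p -> p %| #|T| ->
  exists2 x, x <> one & iter p (mul x) one = one.
Proof.
move=> pr pd; have [x _ ox] : {x : cauchy_carrier | x \in [set: cauchy_carrier]%G & #[x]%g = p}.
  apply: Cauchy => //; rewrite cardsT.
  by have -> : #|{: cauchy_carrier}| = #|T| by apply: (bij_eq_card (f := (fun x : cauchy_carrier => x : T))); exists (fun x : T => x : cauchy_carrier).
exists x.
  move=> x1; move: pr; rewrite -ox (_ : x = 1%g :> cauchy_carrier) // order1.
  by [].
have iterE n : iter n (mul x) one = (x ^+ n)%g :> cauchy_carrier.
  elim: n => [|n IH]; first by rewrite expg0.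
  by rewrite expgS -IH.
by rewrite iterE -ox expg_order.
Qed.
End AbstractCauchy.

(** * The quotient group of cosets *)

Section CauchyCosets.
Local Open Scope classical_set_scope.
Local Open Scope ring_scope.
Variables U H : set algC.
Hypotheses (U0 : forall x, U x -> x != 0) (U1 : U 1)
  (UM : forall x y, U x -> U y -> U (x * y)) (UV : forall x, U x -> U x^-1)
  (HU : forall x, H x -> U x) (H1 : H 1)
  (HM : forall x y, H x -> H y -> H (x * y)) (HV : forall x, H x -> H x^-1)
  (fin : finite_set (cosets U H)).

Let coset x : set algC := [set x * h | h in H].

Let coset_eq x y : U x -> U y -> coset x = coset y <-> H (x^-1 * y).
Proof.
move=> Ux Uy; have x0 := U0 _ Ux; have y0 := U0 _ Uy; split=> [E | h].
  have [h Hh hE] : coset x y by rewrite E; exists 1 => //; rewrite mulr1.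
  by rewrite -hE mulKf.
apply/seteqP; split=> _ [k Hk <-].
  exists ((x^-1 * y)^-1 * k); first by apply: HM => //; apply: HV.
  by field; rewrite x0 y0.
by exists ((x^-1 * y) * k); [apply: HM | rewrite !mulrA mulfV // mul1r].
Qed.

Local Notation T := (fset_set (cosets U H)).

Let repP (c : T) : exists x, U x /\ fsval c = coset x.
Proof.
have := fsvalP c; rewrite in_fset_set // => /set_mem [x Ux <-].
by exists x.
Qed.
Let rep (c : T) : algC := projT1 (cid (repP c)).
Let repU c : U (rep c). Proof. by rewrite /rep; case: cid => x []. Qed.
Let repE c : fsval c = coset (rep c). Proof. by rewrite /rep; case: cid => x []. Qed.

Let mkP x : U x -> coset x \in T.
Proof. by move=> Ux; rewrite in_fset_set //; apply/mem_set; exists x. Qed.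

Let mk x (Ux : U x) : T := FSetSub (mkP x Ux).

Let rep_eq (c d : T) : c = d <-> H ((rep c)^-1 * rep d).
Proof.
rewrite -coset_eq // -!repE; split=> [-> //|]; exact: val_inj.
Qed.

Let rep_mk x (Ux : U x) : H (x^-1 * rep (mk x Ux)).
Proof. by rewrite -coset_eq // -repE. Qed.

Let mk_eq x y (Ux : U x) (Uy : U y) : H (x^-1 * y) -> mk x Ux = mk y Uy.
Proof. by move=> h; apply: val_inj => /=; apply/coset_eq. Qed.

(** Cosets are multiplied through chosen representatives; [repm] supplies the factor in [H] by which
    the representative of [mk x] differs from [x]. *)
Let mul (c d : T) : T := mk _ (UM _ _ (repU c) (repU d)).
Let one : T := mk 1 U1.
Let inv (c : T) : T := mk _ (UV _ (repU c)).

Let H_of_div x y (h : algC) : H h -> U x -> x * h = y -> H (x^-1 * y).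
Proof. by move=> Hh Ux <-; rewrite mulKf // U0. Qed.

Let repm x Ux : exists2 h, H h & rep (mk x Ux) = x * h.
Proof.
exists (x^-1 * rep (mk x Ux)); first exact: rep_mk.
by rewrite mulVKf // U0.
Qed.

Let mulA : associative mul.
Proof.
move=> a b c; apply: mk_eq.
have [h Hh ->] := repm _ (UM _ _ (repU b) (repU c)).
have [k Hk ->] := repm _ (UM _ _ (repU a) (repU b)).
apply: (@H_of_div _ _ (h^-1 * k)); first by apply: HM => //; apply: HV.
  by apply: (UM _ _ (repU a) (UM _ _ (UM _ _ (repU b) (repU c)) (HU _ Hh))).
by have := U0 _ (HU _ Hh); move=> h0; field.
Qed.

Let mul1 : left_id one mul.
Proof.
move=> a; apply/rep_eq; rewrite /mul.
have [h Hh ->] := repm _ (UM _ _ (repU one) (repU a)).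
have [k Hk ->] := repm _ U1.
rewrite mul1r; have -> : (k * rep a * h)^-1 * rep a = k^-1 * h^-1.
  have := U0 _ (HU _ Hh); have := U0 _ (HU _ Hk); have := U0 _ (repU a).
  by move=> *; field; apply/and3P.
by apply: HM; apply: HV.
Qed.

Let mulV : left_inverse one inv mul.
Proof.
move=> a; apply: mk_eq; rewrite /inv.
have [k Hk ->] := repm _ (UV _ (repU a)).
have := U0 _ (HU _ Hk); have := U0 _ (repU a) => a0 k0.
have -> : ((rep a)^-1 * k * rep a)^-1 * 1 = k^-1 by field; apply/andP.
exact: HV.
Qed.

(** [x] represents an element of order [p] in the quotient. Finiteness of the set of cosets makes
    [group_index] the order of that quotient; an infinite index would be 0 and divisible by every
    [p]. *)
Lemma Cauchy_group_index (p : nat) : prime p -> (p %| group_index U H)%N ->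
  exists x, [/\ U x, ~ H x & H (x ^+ p)].
Proof.
move=> pr; rewrite /group_index cardfE => pd.
have [c c1 cp] := @Cauchy_finType _ mul one inv mulA mul1 mulV p pr pd.
exists (rep c); split; first exact: repU.
  move=> Hc; apply: c1; apply/rep_eq.
  have [k Hk ->] := repm _ U1; rewrite mul1r.
  by apply: HM => //; apply: HV.
have iterE n : exists2 h, H h & rep (iter n (mul c) one) = rep c ^+ n * h.
  elim: n => [|n [h Hh IH]] /=.
    by have [k Hk ->] := repm _ U1; exists k.
  have [k Hk ->] := repm _ (UM _ _ (repU c) (repU (iter n (mul c) one))).
  by exists (h * k); [apply: HM | rewrite IH exprS !mulrA].
have [h Hh] := iterE p; rewrite cp; have [k Hk ->] := repm _ U1.
rewrite mul1r => kE; have -> : rep c ^+ p = k * h^-1.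
  by rewrite kE mulfK // U0 //; apply: HU.
by apply: HM => //; apply: HV.
Qed.

End CauchyCosets.

(** * Prime divisors of the index *)

Section PrimeIndex.
Local Open Scope classical_set_scope.
Local Open Scope ring_scope.

Lemma exists_root (R : rcfType) (p : nat) (a : R) : (0 < p)%N -> 1 <= a ->
  exists2 x : R, 0 <= x & x ^+ p = a.
Proof.
move=> p0 a1; have a0 : 0 <= a by apply: le_trans ler01 a1.
have [||x /andP[x0 _] /rootP] := @poly_ivt R ('X^p - a%:P) 0 a => //.
  rewrite !hornerE expr0n gtn_eqF //= sub0r oppr_le0 a0 /= subr_ge0.
  by rewrite -(prednK p0) exprS ler_peMr // exprn_ege1.
by rewrite !hornerE => /eqP; rewrite subr_eq0 => /eqP; exists x.
Qed.

Lemma place_norms (R : realFieldType) (L y : R) : 1 <= L -> 0 <= y <= L^-1 ->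
  [/\ `|- y| = y, `|- y - 1| = 1 + y, `|1 + y| = 1 + y, `|1 + y - 1| = y &
      `|y - L| = L - y /\ `|y - L - 1| = L + 1 - y].
Proof.
move=> L1 /andP[y0 yu]; have {}yu : y <= 1.
  by apply: (le_trans yu); rewrite invf_le1 //; lra.
split; last split.
- by rewrite normrN ger0_norm.
- by rewrite ler0_norm; [ring | lra].
- by rewrite ger0_norm //; lra.
- by rewrite (_ : 1 + y - 1 = y) ?ger0_norm //; ring.
- by rewrite ler0_norm; [ring | lra].
- by rewrite ler0_norm; [ring | lra].
Qed.

Variables (p l : nat) (e : algC).
Hypotheses (p_prime : prime p) (l_ge : ((10000 * p ^ 3) ^ p <= l)%N)
  (re : ennola_root l algC e).
Local Notation U := (unit_group e).
Local Notation H := (generated_subgroup [set -1; e; e - 1]).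

Let p_gt0 : (0 < p)%N := prime_gt0 p_prime.

Let l100 : (100 <= l)%N.
Proof.
apply: leq_trans l_ge; apply: (@leq_trans (10000 * p ^ 3)); last first.
  by rewrite -{1}(expn1 (10000 * p ^ 3)) leq_pexp2l // muln_gt0 expn_gt0 p_gt0.
by apply: (@leq_trans (10000 * 1)); rewrite // leq_mul2l expn_gt0 p_gt0.
Qed.

(* [e ^ I * (e - 1) ^ J] is, up to sign, a [p]-th power of a unit. *)
Definition radical_exponent (I J : int) :=
  exists (x : algC) (s : bool), U x /\ x ^+ p = (-1) ^+ s * e ^ I * (e - 1) ^ J.

(** The new unit is [x ^ k * e ^ i * (e - 1) ^ j]. *)
Lemma radical_exponent_lin (a b k i j : int) : radical_exponent a b ->
  radical_exponent (k * a + p%:Z * i) (k * b + p%:Z * j).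
Proof.
have e0 := gen_neq0 l e re; have e1 := gen_sub1_neq0 l e re.
move=> [x [s [Ux xE]]].
have [t sk] : exists t : bool, ((-1) ^+ s : algC) ^ k = (-1) ^+ t.
  case: s {xE}; last by exists false; rewrite expr0 exp1rz.
  rewrite expr1; case: k => k; first by exists (odd k); rewrite signr_odd.
  by exists (odd k.+1); rewrite NegzE -exprnN invr_sign signr_odd.
exists (x ^ k * e ^ i * (e - 1) ^ j), t; split.
  apply: unit_groupM; first apply: unit_groupM.
  - exact: unit_groupXz.
  - exact: unit_groupXz (unit_group_gen l e re).
  - exact: unit_groupXz (unit_group_gen_sub1 l e re).
rewrite !exprMn exprnP exprzAC -exprnP xE !expfzMl sk.
rewrite !expfzDr // !exprz_exp !exprnP !exprz_exp (mulrC a) (mulrC b) (mulrC i) (mulrC j).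
by ring.
Qed.

Section Trace.
Variables (R : rcfType) (lam : R).
Hypotheses (lam0 : 0 <= lam) (lamE : lam ^+ p = l%:R).

Lemma lam_large : 10000 * p%:R ^+ 3 <= lam.
Proof.
rewrite -(@ler_pXn2r _ p) ?nnegrE //; last by rewrite mulr_ge0 // exprn_ge0.
by rewrite lamE -natrX -natrM -natrX ler_nat.
Qed.

Let exp := main_expansion R p lam.

(** At a real root [r] the conjugate of the unit [x] has an absolute value whose [p]-th power is
    [|r| ^ I * |r - 1| ^ J]. The signs of the conjugates are not controlled, hence [s1], [s2],
    [s3]. *)
Lemma radical_trace (I J : int) : (`|I| <= p)%N -> (`|J| <= p)%N ->
  radical_exponent I J ->
  exists (z : int) (X1 X2 X3 : R) (s1 s2 s3 : bool),
  [/\ exp X1 (- I) (J - I), exp X2 (- J) (I - J *+ 2), exp X3 (I + J) J &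
      z%:~R = (-1) ^+ s1 * X1 + (-1) ^+ s2 * X2 + (-1) ^+ s3 * X3].
Proof.
move=> hI hJ [x [s [Ux xE]]].
have [y1 [y2 [y3 [h1 h2 h3 split_R [e1 e2]]]]] := ennola_real_split l l100 R.
have [fx x0 ax ax'] := proj1 (unit_groupE e x) Ux.
have [q qE] := generated_fieldP l e re x fx.
have [z zE] := trace_int l e q re (eq_ind _ (fun t => t \in Aint) ax _ qE).
have rt t : [|| t == - y1, t == 1 + y2 | t == y3 - l%:R] -> ennola_root l R t.
  by rewrite -(ennola_split_root _ _ _ _ _ _ split_R).
have pE r : ennola_root l R r -> ev R q r != 0 /\
    `|ev R q r| ^+ p = `|r| ^ I * `|r - 1| ^ J.
  move=> rr; have cx : conjugates algC R e r x (ev R q r) by exists q.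
  split; first by rewrite -(conj_eq0 l _ _ _ _ re rr _ _ cx).
  have c1 := conjX _ _ _ _ _ _ p cx.
  have c2 : conjugates algC R e r (x ^+ p) ((-1) ^+ s * place_value R r I J).
    rewrite xE -mulrA; apply: conjM.
      by apply: conjX; apply: conjN; exact: conj1.
    rewrite -[X in conjugates _ _ _ _ X _]mul1r -[X in conjugates _ _ _ _ _ X]mul1r.
    by apply: (conj_unit l) => //; exact: conj1.
  rewrite -normrX (conj_fun l _ _ _ _ re rr _ _ _ c1 c2) normrM normrX normrN1 expr1n mul1r.
  rewrite /place_value normrM.
  have normXz (t : R) (n : int) : `|t ^ n| = `|t| ^ n.
    by case: n => n; rewrite ?NegzE -?exprnN ?normfV normrX.
  by rewrite !normXz.
have [|n1 E1] := pE (- y1); first by apply: rt; rewrite eqxx.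
have [|n2 E2] := pE (1 + y2); first by apply: rt; rewrite eqxx orbT.
have [|n3 E3] := pE (y3 - l%:R); first by apply: rt; rewrite eqxx !orbT.
exists z, `|ev R q (- y1)|, `|ev R q (1 + y2)|, `|ev R q (y3 - l%:R)|.
exists (ev R q (- y1) < 0), (ev R q (1 + y2) < 0), (ev R q (y3 - l%:R) < 0).
have L1 : 1 <= l%:R :> R by rewrite ler1n; apply: leq_trans l100.
have [m1 m1' _ _ _] := place_norms _ _ _ L1 h1.
have [_ _ m2 m2' _] := place_norms _ _ _ L1 h2.
have [_ _ _ _ [m3 m3']] := place_norms _ _ _ L1 h3.
have lg := lam_large.
split.
- apply: (@place1_expansion _ _ _ p_gt0 lg I J _ y1); rewrite ?lamE ?normr_gt0 //.
  by rewrite E1 m1 m1'.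
- apply: (@place2_expansion _ _ _ p_gt0 lg I J _ y2); rewrite ?lamE ?normr_gt0 //.
  by rewrite E2 m2 m2'.
- apply: (@place3_expansion _ _ _ p_gt0 lg I J _ y3); rewrite ?lamE ?normr_gt0 //.
  by rewrite E3 m3 m3'.
by rewrite !mulr_sign_norm (trace_ratP _ _ _ _ _ _ split_R) zE ratr_int.
Qed.

Lemma bezout_modp (a : int) : ~~ (p%:Z %| a)%Z -> exists k i : int, k * a + p%:Z * i = 1.
Proof.
move=> pa; have : coprimez a p%:Z.
  by rewrite coprimezE coprime_sym prime_coprime.
by case/coprimezP => -[k i] /= E; exists k, i; rewrite (mulrC p%:Z).
Qed.

Lemma radical_exponents_dvd (a b : int) : radical_exponent a b ->
  (p%:Z %| a)%Z /\ (p%:Z %| b)%Z.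
Proof.
move=> rab; have lg := lam_large; have p2 := prime_gt1 p_prime.
have lL : lam ^+ p = l%:Z%:~R by rewrite lamE.
have sgn (s t : bool) (X : R) : (-1) ^+ s * ((-1) ^+ t * X) = (-1) ^+ (s (+) t) * X.
  by rewrite signr_addb mulrA.
have sgnn (s : bool) (X : R) : (-1) ^+ s * ((-1) ^+ s * X) = X.
  by rewrite sgn addbb mul1r.
have nsgn (b0 : bool) : `|(-1) ^+ b0 : R| = 1 by rewrite normrX normrN1 expr1n.
have sz (s : bool) (z : int) : ((-1) ^+ s * z)%:~R = (-1) ^+ s * z%:~R :> R.
  by rewrite rmorphM rmorphXn rmorphN1.
have e3 : (0 < p.-1)%N by clear -p2; lia.
have ex1 (I J : int) : radical_exponent I J -> forall I' J', I = I' -> J = J' ->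
    radical_exponent I' J' by move=> ? ? ? <- <-.
(* This refutes each conclusion of [dominant_trace_dvd] obtained below. *)
have ndvd (m : int) (c : bool) : ~ (p%:Z %| m * p%:Z + (-1) ^+ c)%Z.
  case/dvdzP => d E; have {}E : (d - m) * p%:Z = (-1) ^+ c by rewrite mulrBl -E; ring.
  have : (`|d - m| * p)%N = 1%N.
    by rewrite -[p in LHS]/(`|p%:Z|%N) -abszM E abszX exp1n.
  by move/eqP; rewrite muln_eq1 => /andP[_ /eqP p1]; move: p2; rewrite p1.
have [pa|pa] := boolP (p%:Z %| a)%Z; have [pb|pb] := boolP (p%:Z %| b)%Z => //; exfalso.
(* If [p] divides [a] but not [b], the pair [(- p, 1)] is reached: [X1] has size [lam ^ p = l], with
   second order numerator [1 + p]. *)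
- have [k [j kj]] := bezout_modp b pb.
  have /dvdzP[a' aE] := pa.
  have r : radical_exponent (- p%:Z) 1.
    apply: (ex1 _ _ (radical_exponent_lin a b k (- 1 - k * a') j rab)) => //.
    by rewrite aE; ring.
  have [||z [X1 [X2 [X3 [s1 [s2 [s3 [x1 x2 x3 zE]]]]]]]] := radical_trace (- p%:Z) 1 _ _ r.
  + by clear; lia.
  + by clear -p2; lia.
  have := @dominant_trace_dvd R p lam p_gt0 lg l%:Z ((-1) ^+ s1 * z) (1 + p%:Z)
    (- p%:Z - 1 *+ 2) 1 1 p.-1 X1 X2 X3 lL isT e3 _ _ _ x2 _
    ((-1) ^+ (s1 (+) s2)) ((-1) ^+ (s1 (+) s3)) (nsgn _) (nsgn _).
  rewrite sz zE !mulrDr sgnn !sgn => h.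
  have := ndvd 1 false; rewrite mul1r expr0 addrC; apply.
  apply: h => //; [by clear -p2; lia | by clear -p2; lia | |].
    by move: x1; rewrite !opprK.
  by move: x3; congr (exp _ _ _); clear -p2; lia.
(* If [p] divides [b] but not [a], the pair [(1, - p)] makes [X2] dominant, with numerator
   [1 + 2 p]. *)
- have [k [i ki]] := bezout_modp a pa.
  have /dvdzP[b' bE] := pb.
  have r : radical_exponent 1 (- p%:Z).
    apply: (ex1 _ _ (radical_exponent_lin a b k i (- 1 - k * b') rab)) => //.
    by rewrite bE; ring.
  have [||z [X1 [X2 [X3 [s1 [s2 [s3 [x1 x2 x3 zE]]]]]]]] := radical_trace 1 (- p%:Z) _ _ r.
  + by clear -p2; lia.
  + by clear; lia.
  have := @dominant_trace_dvd R p lam p_gt0 lg l%:Z ((-1) ^+ s2 * z) (1 - (- p%:Z) *+ 2)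
    (- p%:Z - 1) (- p%:Z) 1 p.-1 X2 X1 X3 lL isT e3 _ _ _ x1 _
    ((-1) ^+ (s2 (+) s1)) ((-1) ^+ (s2 (+) s3)) (nsgn _) (nsgn _).
  rewrite sz zE !mulrDr sgnn !sgn => h.
  have := ndvd 2 false; apply.
  have -> : 2 * p%:Z + (-1) ^+ false = 1 - (- p%:Z) *+ 2 by rewrite expr0; ring.
  apply: h => //; [by clear -p2; lia | by clear -p2; lia | | |].
  + by move: x2; rewrite opprK.
  + by move: x3; congr (exp _ _ _); clear -p2; lia.
  + by ring.
have [pab|pab] := boolP (p%:Z %| a + b)%Z.
  (* The pair [(1, p - 1)] has sum [p], so [X3] is dominant, with numerator [p - 1]. *)
  have [k [i ki]] := bezout_modp a pa.
  have /dvdzP[c cE] := pab.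
  have r : radical_exponent 1 (p%:Z - 1).
    apply: (ex1 _ _ (radical_exponent_lin a b k i (1 - i - k * c) rab)) => //.
    have -> : k * b = k * (a + b) - k * a by ring.
    have -> : k * a = 1 - p%:Z * i by rewrite -ki; ring.
    by rewrite cE; ring.
  have [||z [X1 [X2 [X3 [s1 [s2 [s3 [x1 x2 x3 zE]]]]]]]] := radical_trace 1 (p%:Z - 1) _ _ r.
  + by clear -p2; lia.
  + by clear -p2; lia.
  have := @dominant_trace_dvd R p lam p_gt0 lg l%:Z ((-1) ^+ s3 * z) (p%:Z - 1)
    (p%:Z - 1 - 1) (1 - (p%:Z - 1) *+ 2) 1 p.-1 X3 X1 X2 lL isT e3 _ _ _ x1 _
    ((-1) ^+ (s3 (+) s1)) ((-1) ^+ (s3 (+) s2)) (nsgn _) (nsgn _).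
  rewrite sz zE !mulrDr sgnn !sgn => h.
  have := ndvd 1 true; rewrite mul1r expr1; apply.
  apply: h => //; [by clear -p2; lia | by clear -p2; lia | | |].
  + by move: x3; congr (exp _ _ _); clear; lia.
  + by move: x2; congr (exp _ _ _); clear -p2; lia.
  + by ring.
have p0 : 0 < p%:Z by rewrite ltz_nat.
have pn0 : p%:Z != 0 by rewrite gt_eqF.
have modE (t : int) : t + p%:Z * - (t %/ p%:Z)%Z = (t %% p%:Z)%Z.
  by rewrite {1}(divz_eq t p%:Z); ring.
(* In the remaining case, scaling by the inverse of [a] or of [b] modulo [p] makes that exponent
   [1 - p] and the other one a residue. *)
have [k [i ki]] := bezout_modp a pa; have [k' [j kj]] := bezout_modp b pb.
set B := (k * b %% p%:Z)%Z; set A := (k' * a %% p%:Z)%Z.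
have rx : radical_exponent (1 - p%:Z) B.
  apply: (ex1 _ _ (radical_exponent_lin a b k (i - 1) (- (k * b %/ p%:Z)%Z) rab)) => //.
  have -> : k * a = 1 - p%:Z * i by rewrite -ki; ring.
  by ring.
have ry : radical_exponent A (1 - p%:Z).
  apply: (ex1 _ _ (radical_exponent_lin a b k' (- (k' * a %/ p%:Z)%Z) (j - 1) rab)) => //.
  have -> : k' * b = 1 - p%:Z * j by rewrite -kj; ring.
  by ring.
(* The residue is nonzero because [m] is invertible modulo [p] and [p] does not divide [d]; it is
   not [p - 1] because [m (c + d)] is congruent to the residue plus 1. *)
have mod_bound (m c d n : int) : m * c + p%:Z * n = 1 -> ~~ (p%:Z %| d)%Z ->
    ~~ (p%:Z %| c + d)%Z -> 0 < (m * d %% p%:Z)%Z < p%:Z - 1.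
  move=> mc pd pcd; have cop : coprimez p%:Z m.
    by apply/coprimezP; exists (n, c) => /=; rewrite -mc; ring.
  set D := (_ %% _)%Z; have D0 : 0 <= D by apply: modz_ge0.
  have Dp : D < p%:Z by apply: ltz_pmod.
  have mdE := divz_eq (m * d) p%:Z; rewrite -/D in mdE.
  have n0 : D != 0.
    apply: contra pd => /eqP D0'; rewrite -(Gauss_dvdzr _ cop) mdE D0' addr0.
    exact: dvdz_mull.
  have n1 : D != p%:Z - 1.
    apply: contra pcd => /eqP D1; rewrite -(Gauss_dvdzr _ cop) mulrDr mdE D1.
    have -> : m * c = 1 - p%:Z * n by rewrite -mc; ring.
    by apply/dvdzP; exists ((m * d %/ p%:Z)%Z + 1 - n); ring.
  by clear -D0 Dp n0 n1; lia.
have B_bound : 0 < B < p%:Z - 1 := mod_bound _ _ _ _ ki pb pab.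
have A_bound : 0 < A < p%:Z - 1.
  by apply: (mod_bound _ _ _ _ kj pa); rewrite addrC.
have [||z [X1 [X2 [X3 [s1 [s2 [s3 [x1 x2 x3 zE]]]]]]]] := radical_trace (1 - p%:Z) B _ _ rx.
- by clear -p2; lia.
- by clear -B_bound; lia.
have [||t [Y1 [Y2 [Y3 [t1 [t2 [t3 [y1 y2 y3 tE]]]]]]]] := radical_trace A (1 - p%:Z) _ _ ry.
- by clear -A_bound; lia.
- by clear -p2; lia.
have [C CE] : exists C : int, C = p%:Z - 1 - B by eexists.
have [D DE] : exists D : int, D = p%:Z - 1 - A by eexists.
(* The traces are subtracted after their dominant terms [X1] and [Y2] are given sign plus. The
   numerators [B + p - 1] and [A + 2 p - 2] differ by [B - A - (p - 1)], which is negative and above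
   [- 2 p]. *)
refine (@dominant_traces_differ R p lam p_gt0 lg ((-1) ^+ s1 * z - (-1) ^+ t2 * t)
  (B - (1 - p%:Z)) (A - (1 - p%:Z) *+ 2) (1 - p%:Z - B *+ 2) B (1 - p%:Z - A) (1 - p%:Z)
  (absz B) (absz C) (absz A) (absz D) X1 X2 X3 Y2 Y1 Y3 _ _ _ _ _ _ _ _ _ _ _ _ _ _ _
  (s1 (+) s2) (s1 (+) s3) (t2 (+) t1) (t2 (+) t3) _).
all: try by clear -p2 A_bound B_bound CE DE; lia.
- by move: x1; congr (exp _ _ _); clear -p2; lia.
- by move: x2; congr (exp _ _ _); clear -B_bound; lia.
- by move: x3; congr (exp _ _ _); clear -B_bound CE; lia.
- by move: y2; congr (exp _ _ _); clear -p2; lia.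
- by move: y1; congr (exp _ _ _); clear -A_bound; lia.
- by move: y3; congr (exp _ _ _); clear -A_bound DE; lia.
rewrite rmorphB /= !sz zE tE !mulrDr !sgnn !sgn; ring.
Qed.

End Trace.

(** Cauchy's theorem gives [x] outside [H] with [x ^ p] in [H]. Both exponents of [x ^ p] are
    multiples of [p], so [x / g] is a root of unity for some [g] in [H]; a real embedding leaves
    only 1 and -1, which puts [x] in [H]. *)
Lemma prime_ndvd_unit_index : ~ (p %| unit_index e)%N.
Proof.
have U0 x : U x -> x != 0 by case/(unit_groupE e).
move=> /(Cauchy_group_index _ _ U0 (unit_group1 e) (unit_groupM e) (unit_groupV e)
  (subgroup_unit l e re) (subgroup1 l e re) (subgroupM l e re) (subgroupV l e re)
  (finite_cosets l e l100 re) p p_prime) [x [Ux nHx Hxp]].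
have [s [a [b xE]]] := proj1 (subgroupP l e re _) Hxp.
have [lam lam0 lamE] : exists2 lam : algR, 0 <= lam & lam ^+ p = l%:R.
  by apply: exists_root => //; rewrite ler1n; apply: leq_trans l100.
have [/dvdzP[a' aE] /dvdzP[b' bE]] : (p%:Z %| a)%Z /\ (p%:Z %| b)%Z.
  by apply: (radical_exponents_dvd algR lam lam0 lamE); exists x, s.
apply: nHx; set g := e ^ a' * (e - 1) ^ b'.
have Hg : H g.
  by apply/(subgroupP l e re); exists false, a', b'; rewrite mul1r.
have g0 : g != 0 by apply: U0; apply: (subgroup_unit l e re).
have [y1 [y2 [y3 [_ _ _ split_R _]]]] := ennola_real_split l l100 algR.
have rr : ennola_root l algR (- y1).
  by rewrite (ennola_split_root _ _ _ _ _ _ split_R) eqxx.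
have Uxg : U (x / g).
  by apply: unit_groupM => //; apply: unit_groupV; apply: (subgroup_unit l e re).
have [q qE] : exists q, x / g = ev algC q e.
  by apply: (generated_fieldP l e re); case/(unit_groupE e): Uxg.
have xgp : (x / g) ^+ p = (-1) ^+ s.
  rewrite exprMn xE aE bE exprVn /g exprMn !exprnP !exprz_exp -mulrA mulfK //.
  by rewrite mulf_neq0 // expfz_neq0 // ?(gen_neq0 l e re) ?(gen_sub1_neq0 l e re).
have cxg : conjugates algC algR e (- y1) (x / g) (ev algR q (- y1)) by exists q.
have [t tE] : exists t : bool, ev algR q (- y1) = (-1) ^+ t.
  have : `|ev algR q (- y1)| = 1.
    apply/eqP; rewrite -(@pexpr_eq1 _ _ p) // -normrX.
    have c1 := conjX _ _ _ _ _ _ p cxg.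
    have c2 : conjugates algC algR e (- y1) ((x / g) ^+ p) ((-1) ^+ s).
      by rewrite xgp; apply: conjX; apply: conjN; exact: conj1.
    by rewrite (conj_fun l _ _ _ _ re rr _ _ _ c1 c2) normrX normrN1 expr1n.
  move=> n1; exists (ev algR q (- y1) < 0).
  by rewrite -[LHS]mulr_sign_norm n1 mulr1.
have xt : x / g = (-1) ^+ t.
  apply: (conj_fun l _ _ _ _ rr re (ev algR q (- y1))); first by exists q.
  rewrite tE; apply: conjX; apply: conjN; exact: conj1.
rewrite -(divfK g0 x) xt; apply: (subgroupM l e re) => //.
by apply/(subgroupP l e re); exists t, 0, 0; rewrite !expr0z !mulr1.
Qed.

End PrimeIndex.

(** * Computability of the bound *)

Lemma prime_dvd_fact_leq p n : prime p -> p %| n`! -> p <= n.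
Proof.
move=> p_prime; elim: n => [|n IH]; first by rewrite dvdn1 => /eqP p1; rewrite p1 in p_prime.
rewrite factS Euclid_dvdM // => /orP[/dvdn_leq-> //|/IH]; exact: leqW.
Qed.

Section Computability.

Definition recursive2 (f : nat -> nat -> nat) :=
  recursive (fun v : 2.-tuple nat => f (tnth v ord0) (tnth v ord_max)).

Lemma recursive_comp1 (n : nat) (f : nat -> nat) (g : n.-tuple nat -> nat) :
  computable f -> recursive g -> recursive (fun v => f (g v)).
Proof.
move=> cf cg; apply: recursive_ext (@recursive_comp 1 n _ (fun=> g) cf (fun=> cg)).
by move=> v; rewrite /thead tnth_mktuple.
Qed.

Lemma recursive_comp2 (n : nat) (f : nat -> nat -> nat) (g h : n.-tuple nat -> nat) :
  recursive2 f -> recursive g -> recursive h -> recursive (fun v => f (g v) (h v)).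
Proof.
move=> cf cg ch.
apply: recursive_ext (@recursive_comp 2 n _ (fun i => if i == ord0 then g else h) cf _).
  by move=> v; rewrite !tnth_mktuple.
by move=> i; case: ifP.
Qed.

Lemma recursive_const (n c : nat) : recursive (fun _ : n.-tuple nat => c).
Proof.
elim: c => [|c IH]; first exact: recursive_zero.
exact: (@recursive_comp1 n succn _ recursive_succ IH).
Qed.

(** Packages [recursive_prim] for the iterations defining addition, multiplication and
    exponentiation, where the step does not look at the counter. *)
Lemma recursive2_rect (f : nat -> nat) (g : nat -> nat -> nat) (F : nat -> nat -> nat) :
  computable f -> recursive2 g ->
  (forall m, F 0 m = f m) -> (forall k m, F k.+1 m = g (F k m) m) -> recursive2 F.
Proof.
move=> cf cg F0 FS.
(* In the triple passed to the step, slot 0 is the counter, slot 1 the previous value and slot 2 the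
   parameter. *)
have cg' : recursive (fun v : 3.-tuple nat =>
    g (tnth v (inord 1)) (tnth v (inord 2))).
  by apply: recursive_comp2 => //; apply: recursive_proj.
have key (w : 1.-tuple nat) k : nat_rect (fun=> nat) (f (thead w))
    (fun k r => (fun v : 3.-tuple nat => g (tnth v (inord 1)) (tnth v (inord 2)))
                  [tuple of k :: r :: w]) k = F k (thead w).
  elim: k => [|k IH] /=; first by rewrite F0.
  by rewrite FS -IH /thead; congr g; rewrite !(tnth_nth 0) /= !inordK.
apply: recursive_ext (recursive_prim cf cg') => v.
by rewrite key /thead !(tnth_nth 0) /= nth_behead.
Qed.

Lemma recursive_addn : recursive2 addn.
Proof.
apply: (@recursive2_rect id (fun a _ => a.+1)) => //.
- exact: recursive_proj.
- exact: (@recursive_comp1 2 succn _ recursive_succ (recursive_proj ord0)).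
Qed.

Lemma recursive_muln : recursive2 muln.
Proof.
apply: (@recursive2_rect (fun=> 0) addn) => //.
- exact: recursive_zero.
- exact: recursive_addn.
- by move=> k m; rewrite mulSn addnC.
Qed.

Lemma recursive_expn : recursive2 expn.
Proof.
(* The recursion runs on the exponent, so the arguments are exchanged afterwards. *)
have h : recursive2 (fun k m => m ^ k).
  apply: (@recursive2_rect (fun=> 1) muln) => //.
  - exact: recursive_const.
  - exact: recursive_muln.
  - by move=> k m; rewrite expnS mulnC.
apply: recursive_ext (@recursive_comp2 2 _ _ _ h (recursive_proj ord_max) (recursive_proj ord0)).
by [].
Qed.

Lemma computable_bound : computable (fun N => (10000 * N ^ 3) ^ N).
Proof.
have id1 : recursive (fun v : 1.-tuple nat => thead v) by exact: recursive_proj.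
apply: (@recursive_comp2 1 expn _ _ recursive_expn) => //.
apply: (@recursive_comp2 1 muln _ _ recursive_muln); first exact: recursive_const.
by apply: (@recursive_comp2 1 expn _ _ recursive_expn) => //; exact: recursive_const.
Qed.

End Computability.

Local Open Scope classical_set_scope.
Theorem theorem1 :
  (forall p : nat, prime p -> 3 <= p ->
     finite_set [set l : nat | 3 <= l /\
       exists e : algC, is_eps l e /\ p %| unit_index e])
  /\
  (exists lN : nat -> nat, computable lN /\
     forall N : nat, 2 <= N ->
     forall (l : nat) (e : algC), 3 <= l -> lN N <= l -> is_eps l e ->
       gcdn (unit_index e) N`! = 1).
Proof.
split=> [p p_prime _|].
  (* All exceptional [l] lie below the threshold of [prime_ndvd_unit_index]. *)
  apply: (@sub_finite_set _ _ `I_((10000 * p ^ 3) ^ p)); last exact: finite_II.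
  move=> l /= [_ [e [re pd]]]; rewrite ltnNge; apply/negP => l_ge.
  exact: (prime_ndvd_unit_index p l e p_prime l_ge re pd).
exists (fun N => (10000 * N ^ 3) ^ N); split; first exact: computable_bound.
move=> N N2 l e _ l_ge re; apply/eqP; apply: contraT => g1.
have g0 : 0 < gcdn (unit_index e) N`! by rewrite gcdn_gt0 fact_gt0 orbT.
(* A gcd other than 1 has a prime factor, which divides [N!] and is therefore at most [N]. *)
have p_prime : prime (pdiv (gcdn (unit_index e) N`!)).
  by apply: pdiv_prime; rewrite ltn_neqAle eq_sym g1.
have := pdiv_dvd (gcdn (unit_index e) N`!); move: p_prime.
set p := pdiv _ => p_prime; rewrite dvdn_gcd => /andP[pd pN].
have pleN := prime_dvd_fact_leq p N p_prime pN.
case: (prime_ndvd_unit_index p l e p_prime _ re pd).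
(* The threshold grows with [p] in both base and exponent, so its value at [N] covers every prime up
   to [N]. *)
apply: leq_trans l_ge; apply: (@leq_trans ((10000 * N ^ 3) ^ p)).
  by rewrite leq_exp2r ?prime_gt0 // leq_mul2l leq_exp2r // pleN orbT.
by rewrite leq_pexp2l // muln_gt0 expn_gt0 (leq_trans _ N2).
Qed.
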